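(* Let $d,k\in\mathbb{N}$, let $Q\subset\mathbb{C}^d$ be a complete circular domain centered at $0\in Q$, let $f(z)=\sum_{n=0}^{\infty}P_n(z)$ (homogeneous polynomial expansion) converge in $Q$, with $a=|f(0)|<1$ and $|f(z)|<1$ for all $z\in Q$, and let $\widehat{\omega}_k\in\mathcal{B}_k$. Then $$\sum_{n=0}^{\infty}|P_n(\widehat{\omega}_k(z))|\le 1$$ in the homothetic domain $(1/\sqrt[k]{3})\,Q$; that is, $\sum_{n=0}^{\infty}|P_n(b)|\,|\widehat{\omega}_k(h)|^n\le 1$ for every $b\in\mathbb{C}^d$ with $b\mathbb{D}\subset Q$ and every $h\in\mathbb{D}$ with $|h|<1/\sqrt[k]{3}$. Moreover, if $Q$ is convex, then the number $1/\sqrt[k]{3}$ is best possible.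
   Context: $\mathbb{D}=\{h\in\mathbb{C}:|h|<1\}$. $\mathcal{B}$ is the set of analytic functions $g$ on $\mathbb{D}$ with $\sup_{\mathbb{D}}|g|\le 1$. For $k\in\mathbb{N}=\{1,2,\dots\}$, $\mathcal{B}_k=\{\omega\in\mathcal{B}:\omega(0)=\omega'(0)=\cdots=\omega^{(k-1)}(0)=0,\ \omega^{(k)}(0)\ne 0\}$ (Schwarz functions). A domain $Q\subset\mathbb{C}^d$ is complete circular (centered at $0\in Q$) if $\lambda z\in Q$ whenever $z\in Q$, $|\lambda|\le 1$. A holomorphic $f$ on $Q$ expands as $f(z)=\sum_{n\ge 0}P_n(z)$ with $P_n(z)=\sum_{|\alpha|=n}A_\alpha z^\alpha$ a homogeneous polynomial of degree $n$ and $P_0=f(0)$. For $R>0$, $RQ=\{Rz:z\in Q\}$. Convention for Schwarz functions on $Q$: restrict to complex lines through the origin. A point of $Q$ is written $z=bh$ with $b\in\mathbb{C}^d$, $b\mathbb{D}:=\{bh:h\in\mathbb{D}\}\subset Q$ and $h\in\mathbb{D}$; then $P_n(\widehat{\omega}(z))$ means $P_n(b\,\widehat{\omega}(h))=P_n(b)\,\widehat{\omega}(h)^n$. An inequality holds in $RQ$ if it holds for all such $b$ and all $|h|<R$. ''Best possible'' means: for every $R'$ with $R<R'\le 1$, where $R$ is the stated number, there exist a function $f$ satisfying the hypotheses on the given $Q$ and a Schwarz function in the stated class for which the inequality does not hold in $R'Q$. (If $Q=\mathbb{C}^d$ all $RQ$ coincide, so the sharpness assertion is understood for $Q\neq\mathbb{C}^d$.)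 *)

(* Defs.v *)
From HB Require Import structures.
From mathcomp Require Import all_boot all_order all_algebra.
From mathcomp Require mpoly.
From mathcomp Require Import complex.
From mathcomp Require Import all_classical all_reals all_analysis.
Import -(notations) mpoly.

Set Implicit Arguments.
Unset Strict Implicit.
Unset Printing Implicit Defensive.

Import Order.TTheory GRing.Theory Num.Theory numFieldNormedType.Exports.

Local Open Scope classical_set_scope.
Local Open Scope ring_scope.

(* The complex field as an abstract field structure over [R[i]], from which the
   library derives its topology and normed module structure. *)
Definition Cplx (R : realType) : numClosedFieldType := R[i].

(* The real-valued modulus; the generic norm [`|z|] has values in [Cplx R]. *)
Definition cmod (R : realType) (z : Cplx R) : R := Normc.normc z.

Definition unit_disc (R : realType) : set (Cplx R) := [set h | cmod h < 1].

(* Local power series at each point of the disc; values of [g] outside the disc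
   are irrelevant. *)
Definition analytic_on_disc (R : realType) (g : Cplx R -> Cplx R) : Prop :=
  forall h0 : Cplx R, unit_disc h0 ->
  exists (r : R) (c : nat -> Cplx R), 0 < r /\
    forall h, cmod (h - h0) < r ->
      series (fun n => c n * (h - h0) ^+ n) @ \oo --> g h.

Definition schur_class (R : realType) (g : Cplx R -> Cplx R) : Prop :=
  analytic_on_disc g /\ forall h : Cplx R, unit_disc h -> cmod (g h) <= 1.

(* [derive1n] is the iterated complex derivative. *)
Definition schwarz_class (R : realType) (k : nat)
    (w : Cplx R -> Cplx R) : Prop :=
  [/\ schur_class w,
      forall j, (j < k)%N -> derive1n j w 0 = 0
    & derive1n k w 0 <> 0].

Definition complete_circular_domain (R : realType) (d : nat)
    (Q : set 'rV[Cplx R]_d) : Prop :=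
  [/\ open Q, connected Q, Q 0
    & forall (z : 'rV[Cplx R]_d) (l : Cplx R),
        Q z -> cmod l <= 1 -> Q (l *: z)].

Definition polyval (R : realType) (d : nat)
    (p : mpoly d (Cplx R)) (z : 'rV[Cplx R]_d) : Cplx R :=
  meval (z ord0) p.

Definition homogeneous (R : realType) (d n : nat) (p : mpoly d (Cplx R)) : Prop :=
  p \is ishomog1 n mdeg.

Definition homogeneous_expansion (R : realType) (d : nat)
    (Q : set 'rV[Cplx R]_d) (f : 'rV[Cplx R]_d -> Cplx R)
    (P : nat -> mpoly d (Cplx R)) : Prop :=
  (forall n, homogeneous n (P n)) /\
  forall z, Q z -> series (fun n => polyval (P n) z) @ \oo --> f z.

(* [differentiable] is over the scalar field [Cplx R], i.e. complex (Frechet)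
   differentiability: [f] is holomorphic on the open set [Q]. *)
Definition bohr_admissible (R : realType) (d : nat)
    (Q : set 'rV[Cplx R]_d) (f : 'rV[Cplx R]_d -> Cplx R)
    (P : nat -> mpoly d (Cplx R)) : Prop :=
  [/\ forall z, Q z -> differentiable f z,
      homogeneous_expansion Q f P,
      cmod (f 0) < 1
    & forall z, Q z -> cmod (f z) < 1].

(* The inequality in [r *: Q]: a point of [Q] is written [h *: b] where the disc
   [{t *: b : |t| < 1}] lies in [Q], and [P n] composed with [w] is evaluated at
   [w h *: b]. The series is summed in the extended reals, so that the
   inequality fails when it diverges. *)
Definition bohr_inequality_in (R : realType) (d : nat)
    (Q : set 'rV[Cplx R]_d) (P : nat -> mpoly d (Cplx R)) (w : Cplx R -> Cplx R)
    (r : R) : Prop :=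
  forall (b : 'rV[Cplx R]_d) (h : Cplx R),
    (forall t : Cplx R, unit_disc t -> Q (t *: b)) ->
    unit_disc h -> cmod h < r ->
    (\sum_(0 <= n <oo) (cmod (polyval (P n) (w h *: b)))%:E <= 1)%E.

(* Main.v *)
Require Import Defs.
From HB Require Import structures.
From mathcomp Require Import all_boot all_order all_algebra.
From mathcomp Require mpoly.
From mathcomp Require Import complex.
From mathcomp Require Import all_classical all_reals all_analysis.
From mathcomp Require Import cyclic separable cyclotomic zify ring lra.
Import -(notations) mpoly.

Import Order.TTheory GRing.Theory Num.Theory numFieldNormedType.Exports.

Local Open Scope classical_set_scope.
Local Open Scope ring_scope.

(** Part one is a problem in one variable. On the line through b the function
    f(t b) has the expansion with coefficients c_n = P_n(b) and it is bounded by 1 on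
    the unit disc. Two facts then suffice.

    - The coefficients satisfy |c_n| <= 2 (1 - |c_0|) for n > 0
      ([bounded_series_coef_le]). This is the Caratheodory inequality for
      1 - e^(i alpha) f; the mean over a circle against a nonnegative trigonometric
      weight, which proves it, is replaced by a mean over roots of unity, applied to
      partial sums ([poly_coef_bound]).
    - A Schwarz function with a zero of order k satisfies |w(h)| <= |h|^k
      ([schwarz_lemma_order], up to a factor r^-k with r < 1). The vanishing
      derivatives give vanishing coefficients by termwise differentiation
      ([power_series_derive1]), and the estimate comes from the maximum principle for
      w(h) / h^k ([max_principle]), which only uses second-order Taylor expansions.

    Hence |w(h)| < 1/3 when |h| < 3^(-1/k), and the sum of the |c_n| |w(h)|^n is at most
    |c_0| + 2 (1 - |c_0|) (1/3 + 1/9 + ...) = 1.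

    For the sharpness one needs a linear functional L with |L| < 1 on Q and
    sup |L| = 1 ([norming_functional]). A convex circular domain Q other than the whole
    space has a point p outside its closure; the functional that separates p from the
    point of the closure closest to p is nonzero and bounded on Q
    ([bounded_functional]), and it is then normalized. The function
    f = (a - L) / (1 - a L) with 0 < a < 1 has P_0 = a and
    P_n = - (1 - a^2) a^(n-1) L^n. With w(h) = h^k and x = |L(b)| |h|^k the sum equals
    a + (1 - a^2) x / (1 - a x), which is larger than 1 if (1 + 2 a) x > 1
    ([moebius_bohr_sum_gt1]); as soon as x > 1/3 some a < 1 has this property. *)

Set Implicit Arguments.
Unset Strict Implicit.
Unset Printing Implicit Defensive.

Arguments cmod {R} z : simpl never.

(** * The real-valued modulus and the topology of the complex field *)

Section Modulus.
Variable R : realType.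
Implicit Types (x y z : Cplx R) (a e r : R).

(** The codomain is [Cplx R] and not the convertible [R[i]], so that the norm
and the order found on both sides of an equation come from the same structure. *)
Definition rc (a : R) : Cplx R := real_complex R a.

Lemma cmodE z : `|z| = rc (cmod z). Proof. by []. Qed.
Lemma rc_le a e : (rc a <= rc e) = (a <= e). Proof. exact: lecR. Qed.
Lemma rc_lt a e : (rc a < rc e) = (a < e). Proof. exact: ltcR. Qed.
Lemma rcI : injective rc. Proof. exact: complexI. Qed.
Lemma rcD a e : rc (a + e) = rc a + rc e.
Proof. exact: (rmorphD (real_complex R)). Qed.
Lemma rcM a e : rc (a * e) = rc a * rc e.
Proof. exact: (rmorphM (real_complex R)). Qed.
Lemma rcX a n : rc (a ^+ n) = rc a ^+ n.
Proof. exact: (rmorphXn (real_complex R)). Qed.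
Lemma rc0 : rc 0 = 0. Proof. by []. Qed.
Lemma rc1 : rc 1 = 1. Proof. by []. Qed.
Lemma rc_nat n : rc n%:R = n%:R. Proof. exact: (rmorph_nat (real_complex R)). Qed.

Lemma cmod_ge0 z : 0 <= cmod z.
Proof. by rewrite -rc_le -cmodE normr_ge0. Qed.
Lemma cmod0 : cmod (0 : Cplx R) = 0.
Proof. by apply: rcI; rewrite -cmodE normr0. Qed.
Lemma cmod1 : cmod (1 : Cplx R) = 1.
Proof. by apply: rcI; rewrite -cmodE normr1. Qed.
Lemma cmodM x y : cmod (x * y) = cmod x * cmod y.
Proof. by apply: rcI; rewrite rcM -!cmodE normrM. Qed.
Lemma cmodX x n : cmod (x ^+ n) = cmod x ^+ n.
Proof. by apply: rcI; rewrite rcX -!cmodE normrX. Qed.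
Lemma cmodN x : cmod (- x) = cmod x.
Proof. by apply: rcI; rewrite -!cmodE normrN. Qed.
Lemma cmodD x y : cmod (x + y) <= cmod x + cmod y.
Proof. by rewrite -rc_le rcD -!cmodE ler_normD. Qed.
Lemma cmodBC x y : cmod (x - y) = cmod (y - x).
Proof. by rewrite -cmodN opprB. Qed.
Lemma cmodB x y : cmod (x - y) <= cmod x + cmod y.
Proof. by rewrite -(cmodN y) cmodD. Qed.
Lemma cmod_dist x y z : cmod (x - y) <= cmod (x - z) + cmod (z - y).
Proof. by apply: le_trans (cmodD _ _); rewrite addrA subrK. Qed.
Lemma cmod_rc a : cmod (rc a) = `|a|.
Proof. by rewrite /cmod /= expr0n /= addr0 sqrtr_sqr. Qed.
Lemma cmod_eq0 z : (cmod z == 0) = (z == 0).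
Proof. by rewrite -(inj_eq rcI) -cmodE normr_eq0. Qed.
Lemma cmod_gt0 z : (0 < cmod z) = (z != 0).
Proof. by rewrite lt_def cmod_ge0 andbT cmod_eq0. Qed.
Lemma cmodV z : cmod z^-1 = (cmod z)^-1.
Proof. exact: (Normc.normcV z). Qed.
Lemma cmod_nat n : cmod (n%:R : Cplx R) = n%:R.
Proof. by rewrite -rc_nat cmod_rc normr_nat. Qed.
Lemma cmod_sum (I : Type) (s : seq I) (P : pred I) (F : I -> Cplx R) :
  cmod (\sum_(i <- s | P i) F i) <= \sum_(i <- s | P i) cmod (F i).
Proof.
elim/big_rec2: _ => [|i y x _ le]; first by rewrite cmod0.
by apply: le_trans (cmodD _ _) _; rewrite lerD2l.
Qed.

Lemma cmod_le_ReIm z : cmod z <= `|complex.Re z| + `|complex.Im z|.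
Proof.
case: z => x y; rewrite [X in cmod X](_ : _ = rc x + Complex 0 1 * rc y);
  last first.
  by rewrite /rc; simpc.
apply: le_trans (cmodD _ _) _; rewrite cmodM !cmod_rc /=.
rewrite lerD2l -[leRHS]mul1r ler_wpM2r //.
by rewrite /cmod /= expr0n expr1n add0r sqrtr1.
Qed.

Lemma nbhs_cmodP z (A : set (Cplx R)) :
  nbhs z A <-> exists2 e : R, 0 < e & forall y, cmod (y - z) < e -> A y.
Proof.
split=> [/nbhs_ballP[e /= e0 H]|[e e0 H]].
  have ei : e = rc (complex.Re e) by rewrite /rc RRe_real ?gtr0_real.
  exists (complex.Re e); first by rewrite -rc_lt -ei.
  move=> y hy; apply: H; rewrite -ball_normE /= distrC cmodE ei rc_lt //.
apply/nbhs_ballP; exists (rc e); rewrite /= ?rc_lt // => y.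
by rewrite -ball_normE /= distrC cmodE rc_lt; exact: H.
Qed.

Lemma cvg_cmodP (u : nat -> Cplx R) (l : Cplx R) :
  u @ \oo --> l <->
  forall e : R, 0 < e -> exists N, forall n, (N <= n)%N -> cmod (u n - l) < e.
Proof.
split=> [H e e0|H A /nbhs_cmodP[e e0 eA]].
  have /H[N _ HN] : nbhs l [set y | cmod (y - l) < e].
    by apply/nbhs_cmodP; exists e.
  by exists N => n nN; exact: HN.
have [N HN] := H e e0.
by exists N => // n /= nN; apply: eA; exact: HN.
Qed.

End Modulus.

(** * Coefficient estimates by averaging over roots of unity *)

Section RootsOfUnity.
Variable C : numClosedFieldType.

(** The polynomial X^n - 1 is separable in characteristic 0, so it has n distinct
roots, and a finite multiplicative group of roots of unity is cyclic. *)
Lemma prim_root_exists n : (0 < n)%N -> exists z : C, n.-primitive_root z.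
Proof.
move=> n_gt0; pose p : {poly C} := 'X^n - 1.
have [r Dp] := closed_field_poly_normal p.
have mon_p : p \is monic by exact: monicXnsubC.
have Ep : p = \prod_(z <- r) ('X - z%:P).
  by rewrite Dp (monicP mon_p) scale1r.
have rn1 : all n.-unity_root r.
  by apply/allP=> z; rewrite -root_prod_XsubC -Ep.
have sz_r : (n < (size r).+1)%N.
  by rewrite -(size_prod_XsubC r id) -Ep size_XnsubC.
have sep_p : separable_poly p.
  by rewrite separable_Xn_sub_1 // pnatr_eq0 -lt0n.
have [|z _ ?] := hasP (has_prim_root n_gt0 rn1 _ sz_r); last by exists z.
by rewrite -separable_prod_XsubC -Ep.
Qed.

Lemma sum_unity_root (K e : nat) (z : C) : K.-primitive_root z ->
  \sum_(j < K) z ^+ (j * e) = if (K %| e)%N then K%:R else 0.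
Proof.
move=> pz; under eq_bigr do rewrite mulnC exprM.
rewrite (prim_order_dvd pz); case: eqP => [->|/eqP ze1].
  by under eq_bigr do rewrite expr1n; rewrite sumr_const card_ord.
apply/eqP; rewrite -(inj_eq (mulfI (_ : z ^+ e - 1 != 0))) ?subr_eq0 //.
by rewrite -subrX1 mulr0 subr_eq0 -exprM mulnC exprM (prim_expr_order pz) expr1n.
Qed.

Lemma polar_form (x : C) : exists2 p : C, `|p| = 1 & x = p * `|x|.
Proof.
have [->|x0] := eqVneq x 0; first by exists 1; rewrite ?normr1// normr0 mulr0.
exists (x / `|x|); last by rewrite divfK // normr_eq0.
by rewrite normf_div normr_id divff // normr_eq0.
Qed.

Lemma norm_add_rotated (x y : C) :
  exists2 u : C, `|u| = 1 & `|x + u * y| = `|x| + `|y|.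
Proof.
have [p p1 Ex] := polar_form x; have [q q1 Ey] := polar_form y.
have q0 : q != 0 by rewrite -normr_eq0 q1 oner_eq0.
exists (p / q); first by rewrite normf_div p1 q1 divr1.
rewrite {1}Ex {1}Ey mulrA divfK // -mulrDr normrM p1 mul1r.
by rewrite ger0_norm // addr_ge0.
Qed.

(** The classical estimate |c_n| <= 2 (1 - |c_0|) for functions bounded by 1, in a
form for polynomials. Let z be a primitive root of unity of order K = 2 N and u a
number of modulus 1. The weights W_j = 2 + u z^(-jn) + conj(u) z^(jn) are
nonnegative, being the squares |1 + u z^(-jn)|^2; they have mean 2, and the mean of
W_j S(r z^j) is 2 c_0 + u c_n r^n because no other exponent below K survives the
averaging. So |2 c_0 + u c_n r^n| <= 2 M for every u, and u is free to turn the
two terms to the same direction. *)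
Lemma poly_coef_bound (N n : nat) (c : nat -> C) (M r : C) :
    0 <= r -> (0 < n < N)%N ->
    (forall t, `|t| = r -> `|\sum_(m < N) c m * t ^+ m| <= M) ->
  2 * `|c 0%N| + `|c n| * r ^+ n <= 2 * M.
Proof.
move=> r0 /andP[n0 nN] bM.
(* The order 2 N is large enough for the term in [z ^+ (j * n)] to vanish too:
   its exponents m + n lie strictly between 0 and 2 N. *)
pose K := (N + N)%N.
have K0 : (0 < K)%N by rewrite /K addn_gt0 (leq_trans n0 (ltnW nN)).
have [z pz] := prim_root_exists K0.
have z1 : `|z| = 1.
  apply/eqP; rewrite -(@pexpr_eq1 _ _ K) // -normrX.
  by rewrite (prim_expr_order pz) normr1.
have [u u1 Eu] := norm_add_rotated (2 * c 0%N) (c n * r ^+ n).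
pose S j := \sum_(m < N) c m * (r * z ^+ j) ^+ m.
pose W j := 2 + u * z ^+ (j * (K - n)) + u^* * z ^+ (j * n).
have W0 j : 0 <= W j.
  have -> : W j = `|1 + u * z ^+ (j * (K - n))| ^+ 2.
    rewrite normCK rmorphD rmorph1 rmorphM /=.
    have zz : z ^+ (j * (K - n)) * z ^+ (j * n) = 1.
      rewrite -exprD -mulnDr subnK; last by rewrite /K ltnW // ltn_addr.
      by rewrite mulnC exprM (prim_expr_order pz) expr1n.
    have -> : (z ^+ (j * (K - n)))^* = z ^+ (j * n).
      have zn : `|z ^+ (j * (K - n))| = 1 by rewrite normrX z1 expr1n.
      have := normCK (z ^+ (j * (K - n))).
      rewrite zn expr1n -zz => /esym/mulfI; apply.
      by rewrite -normr_eq0 zn oner_eq0.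
    have uu : u * u^* = 1 by rewrite -normCK u1 expr1n.
    rewrite mulrDl mul1r mulrDr mulr1 mulrACA uu zz mulr1 /W.
    by ring.
  by rewrite exprn_ge0.
have sumW : \sum_(j < K) W j = 2 * K%:R.
  rewrite /W !big_split /= -!mulr_sumr !(sum_unity_root _ pz).
  have -> : (K %| K - n)%N = false by apply: gtnNdvd; rewrite /K; lia.
  have -> : (K %| n)%N = false by apply: gtnNdvd; rewrite /K; lia.
  by rewrite sumr_const card_ord !mulr0 !addr0; ring.
have sumWS : \sum_(j < K) W j * S j = K%:R * (2 * c 0%N + u * (c n * r ^+ n)).
  pose G m := c m * r ^+ m.
  have E m : (m < N)%N -> \sum_(j < K) W j * (c m * (r * z ^+ j) ^+ m) =
     G m * (2 * (if m == 0 then K%:R else 0) + u * (if m == n then K%:R else 0)).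
    move=> mN; transitivity (\sum_(j < K) G m * (2 * z ^+ (j * m) +
        u * z ^+ (j * (m + (K - n))) + u^* * z ^+ (j * (m + n)))).
      apply: eq_bigr => j _.
      by rewrite /W /G exprMn -exprM !mulnDr !exprD; ring.
    rewrite -mulr_sumr !big_split /= -!mulr_sumr !(sum_unity_root _ pz).
    have -> : (K %| m + n)%N = false.
      by apply: gtnNdvd; rewrite /K; lia.
    have -> : (K %| m)%N = (m == 0).
      case: posnP => [->|m0]; first by rewrite dvdn0.
      by apply: gtnNdvd; rewrite /K; lia.
    have -> : (K %| m + (K - n))%N = (m == n).
      have [->|mn] := eqVneq m n.
        by rewrite subnKC ?dvdnn // /K; lia.
      apply/negP => /dvdnP[q Eq].
      have : (q = 1)%N \/ (q = 0)%N \/ (1 < q)%N by lia.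
      by move: Eq; rewrite /K => Eq [q1|[q1|/leq_mul/(_ (leqnn K))]];
        rewrite ?q1 /K in Eq *; lia.
    by rewrite mulr0 addr0.
  under eq_bigr do rewrite /S mulr_sumr.
  rewrite exchange_big /=; under eq_bigr => m _ do rewrite E //.
  have N0 : (0 < N)%N by lia.
  rewrite (bigD1 (Ordinal N0)) //= (bigD1 (Ordinal nN)) /=; last first.
    by rewrite -val_eqE /= -lt0n.
  rewrite big1 => [|m /andP[m0 mn]].
    by rewrite eq_sym !(gtn_eqF n0) eqxx /G expr0; ring.
  by rewrite -!val_eqE /= in m0 mn; rewrite (negPf m0) (negPf mn); ring.
have KC : (0 : C) < K%:R by rewrite ltr0n.
rewrite -(ler_pM2l KC).
have -> : K%:R * (2 * `|c 0%N| + `|c n| * r ^+ n) = `|\sum_(j < K) W j * S j|.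
  rewrite sumWS normrM Eu normr_nat !normrM normrX (ger0_norm r0).
  by rewrite normr_nat.
apply: le_trans (ler_norm_sum _ _ _) _.
have -> : K%:R * (2 * M) = \sum_(j < K) W j * M by rewrite -mulr_suml sumW; ring.
apply: ler_sum => j _; rewrite normrM (ger0_norm (W0 j)) ler_wpM2l //.
by apply: bM; rewrite normrM normrX z1 expr1n mulr1 ger0_norm.
Qed.

End RootsOfUnity.

(** * Complex series with geometrically dominated terms *)

Section PowerSeries.
Variable R : realType.
Implicit Types (a c : nat -> Cplx R)
  (z l s h : Cplx R) (M q e r : R).

Lemma series_cmodP a l :
  series a @ \oo --> l <-> forall e, 0 < e -> exists N, forall n, (N <= n)%N ->
    cmod (\sum_(i < n) a i - l) < e.
Proof.
rewrite cvg_cmodP; split=> H e e0; have [N HN] := H e e0; exists N => n nN;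
  by have := HN n nN; rewrite seriesEord.
Qed.

Lemma series_terms_bounded a l : series a @ \oo --> l ->
  exists2 M, 0 <= M & forall n, cmod (a n) <= M.
Proof.
move=> /series_cmodP /(_ 1 ltr01)[N HN].
exists (\sum_(i < N) cmod (a i) + 2);
  first by rewrite addr_ge0 ?sumr_ge0 // => i _; exact: cmod_ge0.
move=> n; have [nN|nN] := ltnP n N.
  rewrite (bigD1 (Ordinal nN)) //= -addrA lerDl addr_ge0 ?ler0n //.
  by apply: sumr_ge0 => i _; exact: cmod_ge0.
have -> : a n = (\sum_(i < n.+1) a i - l) - (\sum_(i < n) a i - l).
  by rewrite big_ord_recr /=; ring.
apply: le_trans (cmodB _ _) _.
have := HN n nN; have := HN n.+1 (leqW nN).
have : 0 <= \sum_(i < N) cmod (a i) by apply: sumr_ge0 => i _; exact: cmod_ge0.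
by move: (\sum_(i < N) _) (cmod _) (cmod _) => x y z; lra.
Qed.

Lemma series_limit_bound a l z e N : series a @ \oo --> l ->
  (forall n, (N <= n)%N -> cmod (\sum_(i < n) a i - z) <= e) -> cmod (l - z) <= e.
Proof.
move=> /series_cmodP al H; apply/ler_addgt0Pr => d d0.
have [K HK] := al d d0.
have := HK (maxn N K) (leq_maxr _ _); have := H (maxn N K) (leq_maxl _ _).
move: (\sum_(i < _) _) => S h1 h2.
apply: le_trans (cmod_dist _ _ S) _.
by rewrite (cmodBC l S) addrC lerD // ltW.
Qed.

Lemma geometric_block_le M q m n : 0 <= M -> 0 <= q < 1 ->
  \sum_(m <= i < n) M * q ^+ i <= M * q ^+ m / (1 - q).
Proof.
move=> M0 /andP[q0 q1]; rewrite -mulr_sumr -mulrA ler_wpM2l //.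
have q1' : 0 < 1 - q by rewrite subr_gt0.
rewrite ler_pdivlMr //.
have [mn|nm] := leqP m n; last first.
  by rewrite big_geq ?mul0r ?exprn_ge0 // ltnW.
rewrite -[X in _ <= X]subr0; apply: le_trans (_ : q ^+ m - q ^+ n <= _); last first.
  by rewrite lerD2l lerN2 exprn_ge0.
rewrite le_eqVlt; apply/orP; left; apply/eqP.
rewrite mulrC mulr_sumr -[RHS]opprB -telescope_sumr // -sumrN.
by apply: eq_bigr => i _; rewrite exprS; ring.
Qed.

Lemma series_tail_le a l M q N : series a @ \oo --> l ->
  0 <= q < 1 -> (forall n, cmod (a n) <= M * q ^+ n) ->
  cmod (l - \sum_(i < N) a i) <= M * q ^+ N / (1 - q).
Proof.
move=> al q01 H.
have M0 : 0 <= M by apply: le_trans (cmod_ge0 _) (le_trans (H 0%N) _);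
  rewrite expr0 mulr1.
apply: (series_limit_bound (N := N) al) => n nN.
rewrite -!(big_mkord xpredT a) (@big_cat_nat _ _ _ N) //= addrAC subrr add0r.
apply: le_trans (cmod_sum _ _ _) _.
apply: le_trans (geometric_block_le N n M0 q01).
by apply: ler_sum => i _; exact: H.
Qed.

(** Completeness of the complex field, read off from that of R on real and imaginary
parts. *)
Lemma dominated_series_cvg a M q : 0 <= q < 1 ->
  (forall n, cmod (a n) <= M * q ^+ n) -> exists l, series a @ \oo --> l.
Proof.
move=> /andP[q0 q1] H.
have M0 : 0 <= M by apply: le_trans (cmod_ge0 _) (le_trans (H 0%N) _);
  rewrite expr0 mulr1.
have geo : cvgn (series (geometric M q)).
  by apply: is_cvg_geometric_series; rewrite ger0_norm.
have dom (u : nat -> R) : (forall n, `|u n| <= cmod (a n)) -> cvgn (series u).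
  move=> Hu; apply: normed_cvg; apply: series_le_cvg geo => n //=.
    by rewrite mulr_ge0 // exprn_ge0.
  exact: le_trans (Hu n) (H n).
have /dom/cvg_ex[/= x Hx] : forall n, `|complex.Re (a n)| <= cmod (a n).
  by move=> n; rewrite -rc_le; exact: normc_ge_Re.
have /dom/cvg_ex[/= y Hy] : forall n, `|complex.Im (a n)| <= cmod (a n).
  move=> n; case: (a n) => u v /=; rewrite /cmod /= -sqrtr_sqr ler_wsqrtr //.
  by rewrite lerDr sqr_ge0.
exists (Complex x y); apply/series_cmodP => e e0.
have e20 : 0 < e / 2 by rewrite divr_gt0.
have /cvgrPdist_lt/(_ _ e20)[N1 _ HN1] := Hx.
have /cvgrPdist_lt/(_ _ e20)[N2 _ HN2] := Hy.
exists (maxn N1 N2) => n; rewrite geq_max => /andP[/HN1 h1 /HN2 h2].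
have -> : \sum_(i < n) a i =
    Complex (\sum_(i < n) complex.Re (a i)) (\sum_(i < n) complex.Im (a i)).
  by elim/big_rec3: _ => // i u v w _ ->; case: (a i).
apply: le_lt_trans (cmod_le_ReIm _) _ => /=.
by rewrite distrC [X in _ + X]distrC; move: h1 h2;
  rewrite !seriesEord => h1 h2; rewrite (splitr e) ltrD.
Qed.

(** Difference quotients of powers are controlled by a power at the slightly larger
radius |h| + e, which gives a geometric majorant without any factor n. *)
Lemma power_diff1_le h s n e : cmod s <= e -> 0 < e ->
  cmod ((h + s) ^+ n - h ^+ n) <= cmod s / e * (cmod h + e) ^+ n.
Proof.
move=> se e0; elim: n => [|n IH].
  by rewrite !expr0 subrr cmod0 mulr1 divr_ge0 ?cmod_ge0 // ltW.
have -> : (h + s) ^+ n.+1 - h ^+ n.+1 =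
  h * ((h + s) ^+ n - h ^+ n) + s * (h + s) ^+ n.
  by rewrite !exprS; ring.
apply: le_trans (cmodD _ _) _; rewrite !cmodM exprS.
have -> : cmod s / e * ((cmod h + e) * (cmod h + e) ^+ n) =
  cmod h * (cmod s / e * (cmod h + e) ^+ n) + cmod s * (cmod h + e) ^+ n.
  by field; rewrite gt_eqF.
apply: lerD; first by rewrite ler_wpM2l ?cmod_ge0.
rewrite ler_wpM2l ?cmod_ge0 // cmodX lerXn2r ?nnegrE ?cmod_ge0 //.
  by rewrite addr_ge0 ?cmod_ge0 // ltW.
by apply: le_trans (cmodD _ _) _; rewrite lerD2l.
Qed.

Lemma power_diff2_le h s n e : cmod s <= e -> 0 < e ->
  cmod ((h + s) ^+ n - h ^+ n - s * (n%:R * h ^+ n.-1)) <=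
    (cmod s / e) ^+ 2 * (cmod h + e) ^+ n.
Proof.
move=> se e0; elim: n => [|n IH].
  by rewrite !expr0 subrr mul0r mulr0 subr0 cmod0 mulr1 exprn_ge0 // divr_ge0
    ?cmod_ge0 // ltW.
have -> : (h + s) ^+ n.+1 - h ^+ n.+1 - s * (n.+1%:R * h ^+ n) =
    h * ((h + s) ^+ n - h ^+ n - s * (n%:R * h ^+ n.-1)) +
    s * ((h + s) ^+ n - h ^+ n).
  have -> : h * ((h + s) ^+ n - h ^+ n - s * (n%:R * h ^+ n.-1)) =
      h * (h + s) ^+ n - h ^+ n.+1 - s * (n%:R * h ^+ n).
    by case: n {IH} => [|n] /=; rewrite ?expr0 !exprS; ring.
  by rewrite !exprS -natr1; ring.
apply: le_trans (cmodD _ _) _; rewrite !cmodM [(_ + _) ^+ n.+1]exprS.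
have -> : (cmod s / e) ^+ 2 * ((cmod h + e) * (cmod h + e) ^+ n) =
  cmod h * ((cmod s / e) ^+ 2 * (cmod h + e) ^+ n)
    + cmod s * (cmod s / e * (cmod h + e) ^+ n).
  by field; rewrite gt_eqF.
by apply: lerD; rewrite ler_wpM2l ?cmod_ge0 // power_diff1_le.
Qed.

Lemma power_derive_le h n e : 0 < e ->
  cmod (n%:R * h ^+ n.-1) <= (cmod h + e) ^+ n / e.
Proof.
move=> e0; rewrite cmodM cmod_nat cmodX ler_pdivlMr //.
elim: n => [|n IH]; first by rewrite !mul0r exprn_ge0 // addr_ge0 ?cmod_ge0 // ltW.
rewrite exprS -natr1 /= mulrDl mul1r mulrDl mulrDl lerD //.
  case: n IH => [|n] /= IH; first by rewrite !mul0r mulr_ge0 ?cmod_ge0.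
  by rewrite exprS mulrCA -mulrA ler_wpM2l ?cmod_ge0 // mulrA.
rewrite mulrC ler_wpM2l ?(ltW e0) // lerXn2r ?nnegrE ?cmod_ge0 //.
  by rewrite addr_ge0 ?cmod_ge0 // ltW.
by rewrite lerDl ltW.
Qed.

End PowerSeries.

(** * Termwise differentiation of power series *)

Section TermwiseDerivative.
Variable R : realType.
Implicit Types (a c : nat -> Cplx R) (w : Cplx R -> Cplx R)
  (z l s h : Cplx R) (M q e r : R).

Lemma derive1_cmodP w h l :
  (forall e, 0 < e -> exists2 d, 0 < d & forall s, s != 0 -> cmod s < d ->
     cmod ((w (h + s) - w h) / s - l) <= e) -> derive1 w h = l.
Proof.
move=> H; apply: cvg_lim; first exact: norm_hausdorff.
move=> A /nbhs_cmodP[e e0 eA].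
have [d d0 Hd] := H (e / 2) ltac:(by rewrite divr_gt0).
apply/nbhs_cmodP; exists d => // s; rewrite subr0 => sd s0; apply: eA.
apply: le_lt_trans (_ : e / 2 < e);
  last by rewrite ltr_pdivrMr // mulr_natr mulr2n ltrDl.
by rewrite [_ *: _]mulrC [s + h]addrC; exact: Hd.
Qed.

Lemma series_scale a l z : series a @ \oo --> l ->
  series (fun n => z * a n) @ \oo --> z * l.
Proof.
move=> al; have -> : series (fun n => z * a n) = (fun n => z * series a n).
  by apply/funext => n; rewrite !seriesEord mulr_sumr.
exact: cvgM (cvg_cst _) al.
Qed.

Lemma series_sub a c l z : series a @ \oo --> l -> series c @ \oo --> z ->
  series (fun n => a n - c n) @ \oo --> l - z.
Proof.
move=> al cz; have -> :
    series (fun n => a n - c n) = (fun n => series a n - series c n).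
  by apply/funext => n; rewrite !seriesEord -sumrB.
exact: (cvgB al cz).
Qed.

Lemma series_shift a l : series a @ \oo --> l ->
  series (fun n => a n.+1) @ \oo --> l - a 0%N.
Proof.
move=> /series_cmodP al; apply/series_cmodP => e /al[N HN]; exists N => n nN.
have := HN n.+1 (leqW nN); rewrite big_ord_recl opprB addrA.
by rewrite [_ + a 0%N]addrC.
Qed.

(** The remainder of the first-order expansion of c_n h^n is at most
(|s| / e)^2 |c_n| (|h| + e)^n. With e a quarter of the distance from |h| to r, these
bounds are dominated by a geometric series, hence the remainder of the sum is
O(|s|^2). *)
Lemma power_series_derive1 c w r :
    (forall h, cmod h < r -> series (fun n => c n * h ^+ n) @ \oo --> w h) ->
  forall h, cmod h < r ->
    series (fun n => n.+1%:R * c n.+1 * h ^+ n) @ \oo --> derive1 w h.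
Proof.
move=> cw h hr.
(* The radii |h| < A = |h| + e < rho = |h| + 2 e < r: the series converges at rho,
   which bounds its coefficients, and the derivative is estimated at A. *)
pose e := (r - cmod h) / 4.
have e0 : 0 < e by rewrite divr_gt0 // subr_gt0.
pose A := cmod h + e; pose rho := cmod h + 2 * e.
have h0 := cmod_ge0 h.
have er : 4 * e = r - cmod h by rewrite /e; field.
have A0 : 0 < A by rewrite /A; lra.
have Arho : A < rho by rewrite /A /rho; lra.
have rho_r : rho < r by rewrite /rho; lra.
pose q := A / rho.
have rho0 : 0 < rho by lra.
have q01 : 0 <= q < 1 by rewrite /q divr_ge0 ?ltW //= ltr_pdivrMr // mul1r.
have [M M0 HM] : exists2 M, 0 <= M & forall n, cmod (c n) * rho ^+ n <= M.
  have /cw/series_terms_bounded[M M0 HM] : cmod (rc rho) < r.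
    by rewrite cmod_rc gtr0_norm.
  by exists M => // n; have := HM n; rewrite cmodM cmodX cmod_rc gtr0_norm.
have cA n : cmod (c n) * A ^+ n <= M * q ^+ n.
  rewrite /q expr_div_n mulrA ler_pdivlMr ?exprn_gt0 //.
  by rewrite mulrAC ler_wpM2r // exprn_ge0 // ltW.
have D n : cmod (c n * (n%:R * h ^+ n.-1)) <= M / e * q ^+ n.
  rewrite cmodM.
  apply: le_trans (ler_wpM2l (cmod_ge0 _) (power_derive_le h n e0)) _.
  by rewrite mulrA [leRHS]mulrAC ler_wpM2r // invr_ge0 ltW.
have [d Hd] := dominated_series_cvg q01 D.
have -> : derive1 w h = d.
  apply: derive1_cmodP => eps eps0.
  pose K := M / e ^+ 2 / (1 - q).
  have K0 : 0 <= K.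
    by case/andP: q01 => _ q1; rewrite !divr_ge0 ?exprn_ge0 ?subr_ge0 // ltW.
  have K1 : 0 < K + 1 by rewrite ltr_wpDl.
  exists (Num.min e (eps / (K + 1))); first by rewrite lt_min e0 divr_gt0.
  move=> s s0; rewrite lt_min => /andP[se seps].
  have hs : cmod (h + s) < r by apply: le_lt_trans (cmodD _ _) _; lra.
  have S := series_sub (series_sub (cw _ hs) (cw _ hr)) (series_scale (z := s) Hd).
  have T n :
      cmod (c n * (h + s) ^+ n - c n * h ^+ n - s * (c n * (n%:R * h ^+ n.-1))) <=
      (cmod s / e) ^+ 2 * M * q ^+ n.
    have -> : c n * (h + s) ^+ n - c n * h ^+ n - s * (c n * (n%:R * h ^+ n.-1)) =
      c n * ((h + s) ^+ n - h ^+ n - s * (n%:R * h ^+ n.-1)) by ring.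
    rewrite cmodM.
    apply: le_trans (ler_wpM2l (cmod_ge0 _) (power_diff2_le h n (ltW se) e0)) _.
    by rewrite mulrCA -mulrA ler_wpM2l ?exprn_ge0 // divr_ge0 ?cmod_ge0 // ltW.
  have := series_tail_le 0 S q01 T; rewrite big_ord0 subr0 expr0 mulr1 => B.
  have -> : (w (h + s) - w h) / s - d = (w (h + s) - w h - s * d) / s.
    by rewrite [RHS]mulrBl [s * d]mulrC mulfK.
  rewrite cmodM cmodV ler_pdivrMr ?cmod_gt0 //.
  apply: le_trans B _.
  have -> : (cmod s / e) ^+ 2 * M / (1 - q) = (cmod s * K) * cmod s.
    have q1 : 1 - q != 0 by case/andP: q01 => _ q1; rewrite subr_eq0 gt_eqF.
    rewrite /K; move: (1 - q) q1 => u u0; field.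
    by rewrite u0 gt_eqF.
  rewrite ler_wpM2r ?cmod_ge0 //.
  apply: le_trans (_ : cmod s * (K + 1) <= _).
    by rewrite ler_wpM2l ?cmod_ge0 // lerDl.
  by rewrite -ler_pdivlMr // ltW.
have := series_shift Hd; rewrite mul0r mulr0 subr0.
by rewrite (_ : (fun n => _) = (fun n => n.+1%:R * c n.+1 * h ^+ n)) //;
  apply/funext => n /=; ring.
Qed.

Lemma derive1n_coef c w r j : 0 < r ->
    (forall h, cmod h < r -> series (fun n => c n * h ^+ n) @ \oo --> w h) ->
  derive1n j w 0 = (j`!)%:R * c j.
Proof.
move=> r0; elim: j c w => [|j IH] c w cw.
  have : series (fun n => c n * 0 ^+ n) @ \oo --> w 0 by apply: cw; rewrite cmod0.
  move=> /cvg_cmodP cw0.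
  rewrite fact0 mul1r; apply/eqP; rewrite -subr_eq0 -cmod_eq0.
  rewrite eq_le cmod_ge0 andbT; apply/ler_addgt0Pr => e e0; rewrite add0r.
  have [N /(_ N.+1 (leqnSn N))] := cw0 e e0.
  rewrite seriesEord /= big_ord_recl big1 => [|i _]; last by rewrite expr0n mulr0.
  by rewrite expr0 mulr1 addr0 cmodBC => /ltW.
rewrite derive1Sn (IH _ _ (power_series_derive1 cw)).
by rewrite factS natrM; ring.
Qed.

End TermwiseDerivative.

(** * Second-order expansions, compactness of discs *)

Section MaximumPrinciple.
Variable R : realType.
Implicit Types (a c : nat -> Cplx R) (g w : Cplx R -> Cplx R)
  (z l s h : Cplx R) (M q e r : R).

Definition bounded_near0 (f : Cplx R -> Cplx R) :=
  exists M : R, \forall s \near (0 : Cplx R), cmod (f s) <= M.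

Lemma bounded_near0_cst z : bounded_near0 (fun _ => z).
Proof. by exists (cmod z); near=> s. Unshelve. all: by end_near. Qed.

Lemma bounded_near0_id : bounded_near0 id.
Proof.
exists 1; apply/nbhs_cmodP; exists 1 => // s; rewrite subr0 => /ltW.
exact.
Qed.

Lemma bounded_near0D f g : bounded_near0 f -> bounded_near0 g ->
  bounded_near0 (fun s => f s + g s).
Proof.
move=> [M fM] [N gN]; exists (M + N); near=> s.
apply: le_trans (cmodD _ _) _; apply: lerD; near: s; [exact: fM|exact: gN].
Unshelve. all: by end_near. Qed.

Lemma bounded_near0M f g : bounded_near0 f -> bounded_near0 g ->
  bounded_near0 (fun s => f s * g s).
Proof.
move=> [M fM] [N gN]; exists (M * N); near=> s.
rewrite cmodM; apply: ler_pM; rewrite ?cmod_ge0 //; near: s; [exact: fM|exact: gN].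
Unshelve. all: by end_near. Qed.

(** All that the maximum principle asks of an analytic function: an expansion of
order two with a remainder O(s^3), whose quotient by s^3 is e. Unlike convergent
power series, these expansions are multiplied and inverted by mere algebra. *)
Definition has_jet2 g z := exists (c0 c1 c2 : Cplx R) (e : Cplx R -> Cplx R),
  bounded_near0 e /\
  \forall s \near (0 : Cplx R), g (z + s) =
    c0 + c1 * s + c2 * s ^+ 2 + s ^+ 3 * e s.

Lemma has_jet2_near g w z : (\forall s \near (0 : Cplx R), g (z + s) = w (z + s)) ->
  has_jet2 w z -> has_jet2 g z.
Proof.
move=> gw [c0 [c1 [c2 [e [be we]]]]]; exists c0, c1, c2, e; split=> //.
by apply: filterS2 gw we => s -> ->.
Qed.

Lemma has_jet2M g w z : has_jet2 g z -> has_jet2 w z ->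
  has_jet2 (fun h => g h * w h) z.
Proof.
move=> [a0 [a1 [a2 [e [be ge]]]]] [b0 [b1 [b2 [f [bf wf]]]]].
exists (a0 * b0), (a0 * b1 + a1 * b0), (a0 * b2 + a1 * b1 + a2 * b0).
exists (fun s => (a1 * b2 + a2 * b1) + (a2 * b2) * s
   + e s * (b0 + b1 * s + b2 * (s * s))
   + f s * (a0 + a1 * s + a2 * (s * s) + (s * s) * (s * e s))).
split; last by apply: filterS2 ge wf => s -> ->; ring.
by repeat first [apply: bounded_near0D|apply: bounded_near0M|exact: be|exact: bf
  |exact: bounded_near0_cst|exact: bounded_near0_id].
Qed.

Lemma has_jet2V z : z != 0 -> has_jet2 (fun h => h^-1) z.
Proof.
move=> z0; have cz : 0 < cmod z / 2 by rewrite divr_gt0 // cmod_gt0.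
have near_lb : \forall s \near (0 : Cplx R), cmod z / 2 <= cmod (z + s).
  apply/nbhs_cmodP; exists (cmod z / 2) => // s; rewrite subr0 => sz.
  by have := cmodB (z + s) s; rewrite addrK; lra.
exists z^-1, (- z^-1 ^+ 2), (z^-1 ^+ 3), (fun s => - z^-1 ^+ 3 * (z + s)^-1).
split.
  apply: bounded_near0M; first exact: bounded_near0_cst.
  exists (cmod z / 2)^-1; apply: filterS near_lb => s zs.
  by rewrite cmodV lef_pV2 ?posrE // (lt_le_trans cz).
apply: filterS near_lb => s zs.
have zs0 : z + s != 0 by rewrite -cmod_gt0 (lt_le_trans cz).
by field; rewrite z0 zs0.
Qed.

Lemma has_jet2_cst z h : has_jet2 (fun=> h) z.
Proof.
exists h, 0, 0, (fun=> 0); split; first exact: bounded_near0_cst.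
by near=> s; ring.
Unshelve. all: by end_near. Qed.

Lemma has_jet2VX z k : z != 0 -> has_jet2 (fun h => (h ^+ k)^-1) z.
Proof.
move=> z0; elim: k => [|k IH].
  by under [fun h => _]eq_fun do rewrite expr0; exact: has_jet2_cst.
under [fun h => _]eq_fun do rewrite exprS invfM.
by apply: has_jet2M (has_jet2V z0) _.
Qed.

Lemma power_series_jet2 c g z r : 0 < r ->
  (forall s, cmod s < r -> series (fun n => c n * s ^+ n) @ \oo --> g (z + s)) ->
  has_jet2 g z.
Proof.
move=> r0 cg; pose rho := r / 2.
have rho0 : 0 < rho by rewrite divr_gt0.
have [M M0 HM] : exists2 M, 0 <= M & forall n, cmod (c n) * rho ^+ n <= M.
  have /cg/series_terms_bounded[M M0 HM] : cmod (rc rho) < r.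
    by rewrite cmod_rc gtr0_norm // /rho; lra.
  by exists M => // n; have := HM n; rewrite cmodM cmodX cmod_rc gtr0_norm.
pose P s := c 0%N + c 1%N * s + c 2%N * s ^+ 2.
have tail s : cmod s < rho / 2 ->
  cmod (g (z + s) - P s) <= 2 * M / rho ^+ 3 * cmod s ^+ 3.
  move=> sr; pose q := cmod s / rho.
  have q0 : 0 <= q by rewrite divr_ge0 ?cmod_ge0 // ltW.
  have q2 : q <= 1 / 2 by rewrite /q ler_pdivrMr //; lra.
  have q01 : 0 <= q < 1 by rewrite q0 /=; lra.
  have sr' : cmod s < r by rewrite /rho in sr; lra.
  have T n : cmod (c n * s ^+ n) <= M * q ^+ n.
    rewrite cmodM cmodX /q expr_div_n mulrA ler_pdivlMr ?exprn_gt0 //.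
    by rewrite mulrAC ler_wpM2r // exprn_ge0 ?cmod_ge0.
  have := series_tail_le 3 (cg s sr') q01 T.
  rewrite !big_ord_recr big_ord0 /= expr0 expr1 mulr1 add0r => /le_trans; apply.
  have -> : 2 * M / rho ^+ 3 * cmod s ^+ 3 = M * q ^+ 3 * 2.
    by rewrite /q; field; rewrite gt_eqF.
  rewrite ler_wpM2l //; first by rewrite mulr_ge0 // exprn_ge0.
  by rewrite -div1r ler_pdivrMr; lra.
exists (c 0%N), (c 1%N), (c 2%N), (fun s => (g (z + s) - P s) / s ^+ 3).
have rho2 : 0 < rho / 2 by rewrite divr_gt0.
split.
  exists (2 * M / rho ^+ 3); apply/nbhs_cmodP; exists (rho / 2) => // s;
    rewrite subr0 => /tail T.
  have [->|s0] := eqVneq s 0.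
    rewrite expr0n invr0 mulr0 cmod0 !mulr_ge0 // invr_ge0 exprn_ge0 //; exact: ltW.
  by rewrite cmodM cmodV cmodX ler_pdivrMr // exprn_gt0 // cmod_gt0.
apply/nbhs_cmodP; exists (rho / 2) => // s; rewrite subr0 => /tail T.
have [s0|s0] := eqVneq s 0.
  have -> : g (z + s) = P s.
    apply/eqP; rewrite -subr_eq0 -cmod_eq0 eq_le cmod_ge0 andbT.
    by apply: le_trans T _; rewrite s0 cmod0 expr0n mulr0.
  by rewrite /P subrr mul0r mulr0 addr0.
by rewrite [s ^+ 3 * _]mulrC divfK ?expf_neq0 // /P; ring.
Qed.

Lemma has_jet2_continuous g z : has_jet2 g z -> {for z, continuous g}.
Proof.
move=> [c0 [c1 [c2 [e [[M eM] ge]]]]].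
have M0 : 0 <= M by apply: le_trans (cmod_ge0 _) (nbhs_singleton eM).
have gz : g z = c0.
  by have := nbhs_singleton ge;
    rewrite /= addr0 mulr0 !expr0n /= mulr0 mul0r !addr0.
pose K := cmod c1 + cmod c2 + M.
have K0 : 0 <= K by rewrite !addr_ge0 ?cmod_ge0.
move=> A /nbhs_cmodP[eps eps0 HA].
have /nbhs_cmodP[d d0 Hd] : \forall s \near (0 : Cplx R),
    cmod (e s) <= M /\ g (z + s) = c0 + c1 * s + c2 * s ^+ 2 + s ^+ 3 * e s.
  by apply: filterS2 eM ge.
apply/nbhs_cmodP; exists (Num.min d (Num.min 1 (eps / (K + 1)))).
  by rewrite !lt_min d0 ltr01 divr_gt0 // ltr_wpDl.
move=> y; rewrite !lt_min => /and3P[yd y1 ye]; apply: HA.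
have [|b] := Hd (y - z); first by rewrite subr0.
rewrite addrC subrK gz => ->; move: (y - z) b yd y1 ye => s b yd y1 ye.
have -> : c0 + c1 * s + c2 * s ^+ 2 + s ^+ 3 * e s - c0 =
  s * (c1 + c2 * s + s * s * e s) by ring.
rewrite cmodM; apply: le_lt_trans (_ : cmod s * (K + 1) < _); last first.
  by rewrite -ltr_pdivlMr // ltr_wpDl.
rewrite ler_wpM2l ?cmod_ge0 //.
have s0 := cmod_ge0 s; have s1 := ltW y1.
apply: le_trans (_ : K <= _); last by rewrite lerDl.
rewrite /K; apply: le_trans (cmodD _ _) _; apply: lerD.
  apply: le_trans (cmodD _ _) _; rewrite lerD2l cmodM.
  by rewrite ler_piMr ?cmod_ge0.
by rewrite !cmodM -[leRHS]mul1r ler_pM ?mulr_ge0 ?cmod_ge0 ?mulr_ile1.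
Qed.

Lemma cmod_continuous : continuous (@cmod R).
Proof.
move=> z A /nbhs_ballP[e /= e0 eA]; apply/nbhs_cmodP; exists e => // y yz /=.
apply: eA; rewrite -ball_normE /=; apply: le_lt_trans yz; rewrite ler_norml;
  apply/andP; split.
  by have := cmodD (y - z) z; rewrite subrK; lra.
by have := cmodB y (y - z); rewrite opprB addrC subrK; lra.
Qed.

(** The disc is closed in the image of a square of R^2. *)
Lemma compact_closed_disc r : compact [set z : Cplx R | cmod z <= r].
Proof.
pose f (p : R * R) : Cplx R := Complex p.1 p.2.
have cf : continuous f.
  move=> [x y] A /nbhs_cmodP[e e0 eA].
  have e20 : 0 < e / 2 by rewrite divr_gt0.
  exists (ball x (e / 2), ball y (e / 2)); first by split; exact: nbhsx_ballx.
  move=> [u v] /= [xu yv]; apply: eA.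
  apply: le_lt_trans (cmod_le_ReIm _) _ => /=.
  by rewrite distrC [X in _ + X]distrC (splitr e) ltrD.
pose B : set (R * R) := `[- r, r] `*` `[- r, r].
have cB : compact B by apply: compact_setX; exact: segment_compact.
have : compact (f @` B) by apply: continuous_compact => //;
  exact: continuous_subspaceT.
move=> cfB; apply: (subclosed_compact _ cfB).
  apply: (@closed_comp _ _ (@cmod R) [set x | x <= r]); last exact: closed_le.
  by move=> ? _; exact: cmod_continuous.
move=> [x y] /= zr; exists (x, y) => //.
have x2 : `|x| <= r.
  apply: le_trans zr; rewrite /cmod /= -sqrtr_sqr ler_wsqrtr //.
  by rewrite lerDl sqr_ge0.
have y2 : `|y| <= r.
  apply: le_trans zr; rewrite /cmod /= -sqrtr_sqr ler_wsqrtr //.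
  by rewrite lerDr sqr_ge0.
by split; rewrite /= in_itv /= -ler_norml.
Qed.

(** The inner product of C seen as the Euclidean plane. *)
Definition cdot z h := complex.Re z * complex.Re h + complex.Im z * complex.Im h.

Lemma cmod_sqr z : cmod z ^+ 2 = cdot z z.
Proof. by case: z => x y; rewrite /cmod /cdot /= sqr_sqrtr ?addr_ge0 ?sqr_ge0. Qed.

Lemma cdotDr z h l : cdot z (h + l) = cdot z h + cdot z l.
Proof. by case: z h l => [? ?] [? ?] [? ?]; rewrite /cdot /=; ring. Qed.

Lemma cdotC z h : cdot z h = cdot h z.
Proof. by rewrite /cdot mulrC [X in _ + X]mulrC. Qed.

Lemma cmod_sqrD z h : cmod (z + h) ^+ 2 = cmod z ^+ 2 + 2 * cdot z h + cmod h ^+ 2.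
Proof.
rewrite !cmod_sqr cdotDr ![cdot (z + h) _]cdotC !cdotDr [cdot h z]cdotC.
by ring.
Qed.

Lemma cdot_le z h : `|cdot z h| <= cmod z * cmod h.
Proof.
rewrite -(@ler_pXn2r _ 2) ?nnegrE ?mulr_ge0 ?cmod_ge0 //.
rewrite real_normK ?num_real // exprMn !cmod_sqr.
case: z h => [a b] [c d]; rewrite /cdot /= -subr_ge0.
by apply: le_trans (sqr_ge0 (a * d - b * c)) _; rewrite le_eqVlt; apply/orP;
  left; apply/eqP; ring.
Qed.

End MaximumPrinciple.

(** * The maximum principle and the Schwarz lemma of order k *)

Section SchwarzLemma.
Variable R : realType.
Implicit Types (a c : nat -> Cplx R) (g w : Cplx R -> Cplx R)
  (z l s h : Cplx R) (M q e r : R).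

(** The four directions 1, -1, i, -i annihilate the first- and second-order terms
of the expansion, whence a discrete mean value property up to a third-order
error. *)
Lemma four_point_mean g z : has_jet2 g z -> exists2 M, 0 <= M &
  \forall s \near (0 : Cplx R),
    cmod ((g (z + s) - g z) + (g (z - s) - g z) +
          (g (z + Complex 0 1 * s) - g z) + (g (z - Complex 0 1 * s) - g z)) <=
      M * cmod s ^+ 3.
Proof.
move=> [c0 [c1 [c2 [e [[M eM] ge]]]]].
have M0 : 0 <= M by apply: le_trans (cmod_ge0 _) (nbhs_singleton eM).
have gz : g z = c0.
  by have := nbhs_singleton ge;
    rewrite /= addr0 mulr0 !expr0n /= mulr0 mul0r !addr0.
exists (4 * M); first by rewrite mulr_ge0.
have /nbhs_cmodP[d d0 Hd] : \forall s \near (0 : Cplx R),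
    cmod (e s) <= M /\ g (z + s) = c0 + c1 * s + c2 * s ^+ 2 + s ^+ 3 * e s.
  by apply: filterS2 eM ge.
apply/nbhs_cmodP; exists d => // s; rewrite subr0 => sd.
pose i : Cplx R := Complex 0 1.
have i2 : i * i = -1 by rewrite -expr2; exact: sqr_i.
have i1 : cmod i = 1 by rewrite /cmod /= expr0n expr1n add0r sqrtr1.
rewrite -/i.
have [|b1 ->] := Hd s; first by rewrite subr0.
have [|b2 ->] := Hd (- s); first by rewrite subr0 cmodN.
have [|b3 ->] := Hd (i * s); first by rewrite subr0 cmodM i1 mul1r.
have [|b4 ->] := Hd (- (i * s)); first by rewrite subr0 cmodN cmodM i1 mul1r.
rewrite gz; set e1 := e s in b1 *; set e2 := e (- s) in b2 *.
set e3 := e (i * s) in b3 *; set e4 := e (- (i * s)) in b4 *.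
rewrite [X in cmod X](_ : _ = s ^+ 3 * (e1 - e2 - i * e3 + i * e4)); last first.
  transitivity (c2 * s ^+ 2 * 2 * (1 + i * i) +
    s ^+ 3 * (e1 - e2 + (i * i) * i * (e3 - e4))).
    by ring.
  by rewrite i2; ring.
rewrite cmodM cmodX mulrC ler_wpM2r ?exprn_ge0 ?cmod_ge0 //.
have := cmodD (e1 - e2 - i * e3) (i * e4); have := cmodB (e1 - e2) (i * e3).
by have := cmodB e1 e2; rewrite !cmodM i1; lra.
Qed.

(** Sum the inequality over the four points z + s, z - s, z + i s, z - i s with
|s| = rho. The squares |h|^2 gain 4 rho^2 exactly, while |g|^2 loses at most a
multiple of rho^3 by the four-point mean; for small rho this is a
contradiction. *)
Lemma no_interior_max g z e r : 0 < e -> cmod z < r -> has_jet2 g z ->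
  ~ (forall h, cmod h <= r ->
       cmod (g h) ^+ 2 + e * cmod h ^+ 2 <= cmod (g z) ^+ 2 + e * cmod z ^+ 2).
Proof.
move=> e0 zr /four_point_mean[M M0 /nbhs_cmodP[d d0 Hd]] H.
pose K := cmod (g z) * M.
have K0 : 0 <= K by rewrite mulr_ge0 ?cmod_ge0.
(* The last bound gives K rho <= e, against the comparison
   4 e rho^2 <= 2 K rho^3 reached in the end. *)
pose rho := Num.min (d / 2) (Num.min (r - cmod z) (e / (K + 1))).
have rho0 : 0 < rho by rewrite !lt_min subr_gt0 zr !divr_gt0 ?ltr_wpDl.
have [rd rz re] : [/\ rho < d, rho <= r - cmod z & rho <= e / (K + 1)].
  split; rewrite /rho ?ge_min ?lexx ?orbT //.
  by rewrite gt_min; apply/orP; left; lra.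
pose i : Cplx R := Complex 0 1.
have i1 : cmod i = 1 by rewrite /cmod /= expr0n expr1n add0r sqrtr1.
pose s := rc rho.
have sr : cmod s = rho by rewrite cmod_rc gtr0_norm.
have isr : cmod (i * s) = rho by rewrite cmodM i1 mul1r.
have := Hd s; rewrite subr0 sr -/i => /(_ rd).
set a1 := g (z + s) - g z; set a2 := g (z - s) - g z.
set a3 := g (z + i * s) - g z; set a4 := g (z - i * s) - g z => B.
have F h : cmod h <= rho ->
  2 * cdot (g z) (g (z + h) - g z) + e * (2 * cdot z h + cmod h ^+ 2) <= 0.
  move=> hr; have /H : cmod (z + h) <= r by apply: le_trans (cmodD _ _) _; lra.
  have {1}-> : g (z + h) = g z + (g (z + h) - g z) by ring.
  rewrite (cmod_sqrD (g z)) (cmod_sqrD z).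
  have := sqr_ge0 (cmod (g (z + h) - g z)); lra.
have f1 := F s; have f2 := F (- s); have f3 := F (i * s); have f4 := F (- (i * s)).
move: f1 f2 f3 f4; rewrite !cmodN sr isr lexx.
rewrite -/a1 -/a2 -/a3 -/a4 => /(_ isT) f1 /(_ isT) f2 /(_ isT) f3 /(_ isT) f4.
have D0 x y : cdot x (- y) = - cdot x y.
  by case: x y => [? ?] [? ?]; rewrite /cdot /=; ring.
rewrite !D0 in f2 f4.
clearbody a1 a2 a3 a4.
have : `|cdot (g z) (a1 + a2 + a3 + a4)| <= K * rho ^+ 3.
  apply: le_trans (cdot_le _ _) _.
  by rewrite /K -mulrA ler_wpM2l ?cmod_ge0.
rewrite !cdotDr ler_norml => /andP[low _].
have : 4 * e * rho ^+ 2 <= 2 * (K * rho ^+ 3) by lra.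
have -> : K * rho ^+ 3 = (K * rho) * rho ^+ 2 by ring.
rewrite mulrA ler_pM2r ?exprn_gt0 //.
have : K * rho <= e.
  by move: re; rewrite ler_pdivlMr ?ltr_wpDl //; lra.
lra.
Qed.

(** The perturbation d |h|^2 turns the maximum principle into a strict one: the
maximum of |g|^2 + d |h|^2 on the closed disc exists by compactness and cannot lie
inside. Letting d tend to 0 removes the perturbation. *)
Lemma max_principle g r M : 0 < r -> 0 <= M ->
  (forall h, cmod h <= r -> has_jet2 g h) ->
  (forall h, cmod h = r -> cmod (g h) <= M) ->
  forall h, cmod h <= r -> cmod (g h) <= M.
Proof.
move=> r0 M0 jg bd h hr.
rewrite -(@ler_pXn2r _ 2) ?nnegrE ?cmod_ge0 //.
apply/ler_addgt0Pr => e e0.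
pose d := e / r ^+ 2.
have d0 : 0 < d by rewrite divr_gt0 ?exprn_gt0.
pose phi z := cmod (g z) ^+ 2 + d * cmod z ^+ 2.
have A0 : [set z : Cplx R | cmod z <= r] !=set0.
  by exists (0 : Cplx R); rewrite /= cmod0 ltW.
have cphi : {within [set z : Cplx R | cmod z <= r], continuous phi}.
  apply: continuous_in_subspaceT => z; rewrite inE /= => /jg/has_jet2_continuous cg.
  have c1 : {for z, continuous (fun z => cmod (g z))}.
    exact: continuous_comp cg (@cmod_continuous _ _).
  have c2 : {for z, continuous (@cmod R)} by exact: cmod_continuous.
  have -> : phi = (fun z => cmod (g z) * cmod (g z) + d * (cmod z * cmod z)).
    by apply/funext => y; rewrite /phi !expr2.
  exact: (cvgD (cvgM c1 c1) (cvgM (cvg_cst d) (cvgM c2 c2))).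
have [z] := compact_EVT_max A0 (@compact_closed_disc R r) cphi.
rewrite inE /= => zr max.
have max' x : cmod x <= r -> phi x <= phi z by move=> xr; apply: max; rewrite inE.
move: zr; rewrite le_eqVlt => /orP[/eqP zr|zr]; last first.
  by case: (no_interior_max d0 zr (jg _ (ltW zr)) max').
apply: le_trans (_ : phi h <= _).
  by rewrite lerDl mulr_ge0 ?exprn_ge0 ?cmod_ge0 // ltW.
apply: le_trans (max' _ hr) _.
rewrite /phi zr /d divfK ?gt_eqF ?exprn_gt0 // lerD2r.
by rewrite ler_pXn2r ?nnegrE ?cmod_ge0 ?bd.
Qed.

Lemma series_shiftn a l n : series a @ \oo --> l ->
  series (fun i => a (n + i)%N) @ \oo --> l - \sum_(i < n) a i.
Proof.
elim: n => [|n IH] al; first by rewrite big_ord0 subr0.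
have -> : (fun i => a (n.+1 + i)%N) = (fun i => a (n + i.+1)%N).
  by apply/funext => i; rewrite addnS.
have H := series_shift (IH al); rewrite addn0 in H.
by rewrite big_ord_recr opprD addrA; exact: H.
Qed.

(** The quotient w(h) / h^k, completed by the coefficient c_k at the origin, still
has expansions of order two at every point, and it is bounded by r^-k on the circle
of radius r; the maximum principle carries this bound inside. *)
Lemma schwarz_lemma_order k w r h : schwarz_class k w -> 0 < r < 1 -> cmod h <= r ->
  cmod (w h) <= (cmod h / r) ^+ k.
Proof.
move=> [[an bw] wj wk] /andP[r0 r1] hr.
have d0 : unit_disc (0 : Cplx R) by rewrite /unit_disc /= cmod0.
have [p [c [p0 Hc]]] := an 0 d0.
have cw s : cmod s < p -> series (fun n => c n * s ^+ n) @ \oo --> w s.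
  by move=> sp; have := Hc s; rewrite subr0; apply.
have c0 j : (j < k)%N -> c j = 0.
  move=> /wj; rewrite (derive1n_coef j p0 cw) => /eqP.
  by rewrite mulf_eq0 pnatr_eq0 -leqn0 leqNgt fact_gt0 /= => /eqP.
pose g z := if z == 0 then c k else w z / z ^+ k.
have jg z : cmod z <= r -> has_jet2 g z.
  move=> zr; have [->|z0] := eqVneq z 0.
    apply: (power_series_jet2 (c := fun n => c (k + n)%N) p0) => s sp.
    rewrite add0r /g; case: eqVneq => [s0|s0].
      apply/cvg_cmodP => e e0; exists 1%N => n n0; rewrite seriesEord /=.
      case: n n0 => // n _; rewrite big_ord_recl big1 => [|i _].
        by rewrite expr0 mulr1 addr0 addn0 subrr cmod0.
      by rewrite s0 expr0n mulr0.
    have S := series_shiftn (n := k) (cw s sp).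
    rewrite big1 ?subr0 in S; last by move=> i _; rewrite c0 ?mul0r.
    have := series_scale (z := (s ^+ k)^-1) S; rewrite mulrC.
    rewrite [X in series X @ _ --> _](_ : _ = (fun n => c (k + n)%N * s ^+ n));
      first exact.
    by apply/funext => n; rewrite exprD; field; rewrite expf_neq0.
  apply: (has_jet2_near (w := fun z => w z * (z ^+ k)^-1)).
    apply/nbhs_cmodP; exists (cmod z); rewrite ?cmod_gt0 // => s;
      rewrite subr0 => sz.
    rewrite /g ifN // -cmod_gt0.
    by have := cmodB (z + s) s; rewrite addrK; lra.
  apply: has_jet2M (has_jet2VX k z0).
  have [|q [b [q0 Hb]]] := an z; first exact: le_lt_trans r1.
  apply: (power_series_jet2 q0 (c := b)) => s sq.
  by have := Hb (z + s); rewrite addrC addKr; exact.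
have bg z : cmod z = r -> cmod (g z) <= (r ^+ k)^-1.
  move=> zr; have z0 : z != 0 by rewrite -cmod_gt0 zr.
  rewrite /g ifN // cmodM cmodV cmodX zr ler_piMl //;
    first by rewrite invr_ge0 exprn_ge0 // ltW.
  by apply: bw; rewrite /unit_disc /= zr.
have rk : 0 <= (r ^+ k)^-1 by rewrite invr_ge0 exprn_ge0 // ltW.
have := max_principle r0 rk jg bg hr.
rewrite /g; case: eqVneq => [->|h0].
  rewrite cmod0 mul0r expr0n => _.
  have [k0|k0] := posnP k; first by rewrite bw.
  have := derive1n_coef 0 p0 cw; rewrite /= fact0 mul1r c0 // => ->.
  by rewrite cmod0.
rewrite cmodM cmodV cmodX ler_pdivrMr ?exprn_gt0 ?cmod_gt0 // => /le_trans; apply.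
by rewrite expr_div_n mulrC.
Qed.

End SchwarzLemma.

(** * The Bohr inequality *)

Section BohrInequality.
Variable R : realType.
Implicit Types (c : nat -> Cplx R) (w : Cplx R -> Cplx R)
  (z l s h : Cplx R) (M q e r : R).

Lemma geometric_eventually_le q M e : 0 <= q < 1 -> 0 < e ->
  exists N, forall n, (N <= n)%N -> M * q ^+ n <= e.
Proof.
move=> /andP[q0 q1] e0.
have /cvgrPdist_le/(_ _ e0)[N _ HN] : geometric M q @ \oo --> 0.
  by apply: cvg_geometric; rewrite ger0_norm.
exists N => n /HN; rewrite /= sub0r normrN => /(le_trans _); apply.
exact: ler_norm.
Qed.

(** On the circle of radius r the partial sums are bounded by 1 + e / 2 as soon as
they are long enough, and the bound for polynomials applies to them. *)
Lemma bounded_series_coef_le c (F : Cplx R -> Cplx R) r n :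
  (forall t, unit_disc t -> series (fun n => c n * t ^+ n) @ \oo --> F t) ->
  (forall t, unit_disc t -> cmod (F t) <= 1) ->
  0 < r < 1 -> (0 < n)%N -> cmod (c n) * r ^+ n <= 2 * (1 - cmod (c 0%N)).
Proof.
move=> cF bF /andP[r0 r1] n0.
(* An auxiliary radius between r and 1, to make the convergence on the circle of
   radius r geometric. *)
pose rho := (1 + r) / 2.
have rho0 : 0 < rho by rewrite /rho; lra.
have rr : r < rho by rewrite /rho; lra.
have [M M0 HM] : exists2 M, 0 <= M & forall n, cmod (c n) * rho ^+ n <= M.
  have /cF/series_terms_bounded[M M0 HM] : unit_disc (rc rho).
    by rewrite /unit_disc /= cmod_rc gtr0_norm // /rho; lra.
  by exists M => // m; have := HM m; rewrite cmodM cmodX cmod_rc gtr0_norm.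
pose q := r / rho.
have q01 : 0 <= q < 1 by rewrite /q divr_ge0 ?(ltW r0) ?(ltW rho0) //=
  ltr_pdivrMr // mul1r.
have cr m : cmod (c m) * r ^+ m <= M * q ^+ m.
  rewrite /q expr_div_n mulrA ler_pdivlMr ?exprn_gt0 //.
  by rewrite mulrAC ler_wpM2r // exprn_ge0 // ltW.
suff : 2 * cmod (c 0%N) + cmod (c n) * r ^+ n <= 2 by lra.
apply/ler_addgt0Pr => e e0.
have e20 : 0 < e / 2 by rewrite divr_gt0.
have [N HN] := geometric_eventually_le (M / (1 - q)) q01 e20.
have Nn : (0 < n < maxn N n.+1)%N by rewrite n0 leq_max ltnSn orbT.
have bS t : `|t| = rc r -> `|\sum_(m < maxn N n.+1) c m * t ^+ m| <= rc (1 + e / 2).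
  rewrite !cmodE => /rcI tr; rewrite rc_le.
  have t1 : unit_disc t by rewrite /unit_disc /= tr.
  have T m : cmod (c m * t ^+ m) <= M * q ^+ m by rewrite cmodM cmodX tr.
  have := series_tail_le (maxn N n.+1) (cF t t1) q01 T.
  set S := \sum_(m < _) _ => B.
  have := cmodB (F t) (F t - S); rewrite opprB addrC subrK => /le_trans; apply.
  apply: lerD; first exact: bF.
  by apply: le_trans B _; rewrite mulrAC HN // leq_maxl.
have r0C : 0 <= rc r by rewrite -rc0 rc_le ltW.
have := poly_coef_bound r0C Nn bS.
rewrite -rcX -(rc_nat R 2) !cmodE -!rcM -rcD rc_le.
by move=> /le_trans; apply; rewrite le_eqVlt; apply/orP; left; apply/eqP; field.
Qed.

Lemma polyval_homogeneous d n (p : mpoly d (Cplx R)) (t : Cplx R)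
    (z : 'rV[Cplx R]_d) :
  homogeneous n p -> polyval p (t *: z) = t ^+ n * polyval p z.
Proof.
move=> /dhomogP hp; rewrite /polyval !mevalE mulr_sumr.
rewrite big_seq [RHS]big_seq; apply: eq_bigr => m mp.
have <- : mdeg m = n by exact: hp.
rewrite mulrCA; congr (_ * _); rewrite mdegE -prodrXr -big_split /=.
by apply: eq_bigr => i _; rewrite mxE exprMn.
Qed.

Lemma radius_powk (k : nat) : (0 < k)%N -> (1 / 3 `^ (k%:R^-1) : R) ^+ k = 1 / 3.
Proof.
move=> k0; rewrite expr_div_n expr1n -powR_mulrn ?powR_ge0 // -powRrM mulVf
  ?powRr1 //.
by rewrite pnatr_eq0 -lt0n.
Qed.

(** The majorant sums to |c_0| + 2 (1 - |c_0|) / 2 = 1, since the powers of 1/3 of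
positive exponent add up to 1/2. *)
Lemma bohr_sum_le c (x : R) : cmod (c 0%N) <= 1 -> 0 <= x ->
  (forall n, (0 < n)%N ->
    cmod (c n) * x ^+ n <= 2 * (1 - cmod (c 0%N)) * (1 / 3) ^+ n) ->
  forall n, \sum_(0 <= i < n) cmod (c i) * x ^+ i <= 1.
Proof.
move=> c01 x0 H [|n]; first by rewrite big_geq.
rewrite big_ltn // expr0 mulr1.
have le : \sum_(1 <= i < n.+1) cmod (c i) * x ^+ i <=
    \sum_(1 <= i < n.+1) 2 * (1 - cmod (c 0%N)) * (1 / 3) ^+ i.
  by rewrite big_nat_cond [leRHS]big_nat_cond;
    apply: ler_sum => i /andP[/andP[i0 _] _]; exact: H.
have M0 : 0 <= 2 * (1 - cmod (c 0%N)) by rewrite mulr_ge0 // subr_ge0.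
have q3 : 0 <= (1 / 3 : R) < 1 by apply/andP; split; lra.
have := geometric_block_le 1 n.+1 M0 q3; rewrite expr1.
have -> : 2 * (1 - cmod (c 0%N)) * (1 / 3) / (1 - 1 / 3) =
  1 - cmod (c 0%N) by field.
lra.
Qed.

(** On the line through b, the coefficients c_n = P_n(b) are those of a function
of one variable bounded by 1. The strict inequality |h| < 3^(-1/k) leaves room for a
radius r < 1 in the Schwarz lemma and for a radius r' < 1 in the coefficient
estimate. *)
Lemma bohr_inequality (d k : nat) (Q : set 'rV[Cplx R]_d) f P w :
  (0 < k)%N -> bohr_admissible Q f P -> schwarz_class k w ->
  bohr_inequality_in Q P w (1 / 3 `^ (k%:R^-1)).
Proof.
move=> k0 [_ [homP expP] _ fQ] wk b h bQ h1 hH.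
pose H : R := 1 / 3 `^ (k%:R^-1).
have H0 : 0 < H by rewrite divr_gt0 // powR_gt0.
have Hk : H ^+ k = 1 / 3 by exact: radius_powk.
have H1 : H <= 1.
  by rewrite -(@ler_pXn2r _ k) // ?nnegrE ?ler01 ?(ltW H0) // Hk expr1n; lra.
rewrite -/H in hH.
have h0 := cmod_ge0 h.
pose u := cmod h / H.
have u0 : 0 <= u by rewrite divr_ge0 // ltW.
have u1 : u < 1 by rewrite /u ltr_pdivrMr // mul1r.
have hu : cmod h <= u by rewrite /u ler_pdivlMr // ler_piMr.
have hHu : cmod h = u * H by rewrite /u divfK // gt_eqF.
(* Any r strictly between u and 1 gives |h| / r < H, hence y < 1/3 below. *)
pose r := (u + 1) / 2.
have r01 : 0 < r < 1 by apply/andP; rewrite /r; split; lra.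
have r0 : 0 < r by case/andP: r01.
have hr : cmod h <= r by rewrite /r; lra.
pose y := (cmod h / r) ^+ k.
have y3 : y < 1 / 3.
  rewrite -Hk /y ltr_pXn2r //; first last.
  - by rewrite nnegrE ltW.
  - by rewrite nnegrE divr_ge0 // ltW.
  by rewrite ltr_pdivrMr // hHu mulrC ltr_pM2l // /r; lra.
have y0 : 0 <= y by rewrite /y exprn_ge0 // divr_ge0 // ltW.
have wy : cmod (w h) <= y by exact: schwarz_lemma_order.
clearbody y.
(* Both y <= r' / 3 and r' < 1 follow from 3 y < 1. *)
pose r' := (3 * y + 1) / 2.
have r'01 : 0 < r' < 1 by apply/andP; rewrite /r'; split; lra.
pose c n := polyval (P n) b.
have cF t : unit_disc t -> series (fun n => c n * t ^+ n) @ \oo --> f (t *: b).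
  move=> t1; have := expP (t *: b) (bQ t t1).
  rewrite (_ : (fun n => _) = (fun n => c n * t ^+ n)); first exact.
  by apply/funext => n; rewrite (polyval_homogeneous _ _ (homP _)) mulrC.
have bF t : unit_disc t -> cmod (f (t *: b)) <= 1.
  by move=> t1; apply/ltW/fQ/bQ.
have C n : (0 < n)%N -> cmod (c n) * r' ^+ n <= 2 * (1 - cmod (c 0%N)).
  exact: bounded_series_coef_le cF bF r'01.
have c01 : cmod (c 0%N) <= 1.
  have := C 1%N isT; have : 0 <= cmod (c 1%N) * r' ^+ 1.
    by rewrite mulr_ge0 ?cmod_ge0 // exprn_ge0 //; case/andP: r'01 => /ltW.
  lra.
have part n : \sum_(0 <= i < n) cmod (c i) * cmod (w h) ^+ i <= 1.
  apply: bohr_sum_le => //; first exact: cmod_ge0.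
  move=> m m0; apply: le_trans (_ : cmod (c m) * (r' * (1 / 3)) ^+ m <= _).
    rewrite ler_wpM2l ?cmod_ge0 // lerXn2r ?nnegrE ?cmod_ge0 //.
      by rewrite /r'; lra.
    by apply: le_trans wy _; rewrite /r'; lra.
  by rewrite exprMn mulrA ler_wpM2r ?C // exprn_ge0 // divr_ge0.
apply: lime_le; first by apply: is_cvg_nneseries => n _ _; rewrite lee_fin cmod_ge0.
near=> n; rewrite sumEFin lee_fin; apply: le_trans (part n).
apply: ler_sum => i _.
by rewrite (polyval_homogeneous _ _ (homP _)) cmodM cmodX mulrC.
Unshelve. all: by end_near. Qed.

End BohrInequality.

(** * A bounded linear functional on a proper convex circular domain *)

Section BoundedFunctional.
Variables (R : realType) (d : nat).
Implicit Types (x y z p v : 'rV[Cplx R]_d) (Q : set 'rV[Cplx R]_d).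

Lemma nbhs_rowP z (A : set 'rV[Cplx R]_d) :
  nbhs z A <-> exists2 e : R, 0 < e &
    forall y, (forall i, cmod (y ord0 i - z ord0 i) < e) -> A y.
Proof.
split=> [/nbhs_ballP[e /= e0 H]|[e e0 H]].
  have ei : e = rc (complex.Re e) by rewrite /rc RRe_real ?gtr0_real.
  exists (complex.Re e); first by rewrite -rc_lt -ei.
  move=> y hy; apply: H; split=> // i j; rewrite (ord1 i).
  by rewrite -ball_normE /= distrC cmodE ei rc_lt.
apply/nbhs_ballP; exists (rc e); rewrite /= ?rc_lt // => y [_ hy].
apply: H => i; have := hy ord0 i.
by rewrite -ball_normE /= distrC cmodE rc_lt.
Qed.

Lemma convex_setE Q x y (t : R) : convex_set Q -> Q x -> Q y -> 0 <= t <= 1 ->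
  Q ((1 - rc t) *: x + rc t *: y).
Proof.
move=> cQ Qx Qy /andP[t0 t1].
have t0' : 0 <= rc t by rewrite -rc0 rc_le.
have t1' : rc t <= 1 by rewrite -rc1 rc_le.
have := cQ y x (Itv01 t0' t1'); rewrite !inE addrC; apply=> //.
Qed.

Definition linval v z : Cplx R := \sum_i v ord0 i * z ord0 i.

Lemma linvalZ v (t : Cplx R) z : linval v (t *: z) = t * linval v z.
Proof. by rewrite /linval mulr_sumr; apply: eq_bigr => i _; rewrite mxE mulrCA. Qed.

Definition sqdist x y : R := \sum_i cmod (x ord0 i - y ord0 i) ^+ 2.

Lemma sqdist_continuous p : continuous (fun z => sqdist z p).
Proof.
have c1 i : continuous (fun z =>
  cmod (z ord0 i - p ord0 i) * cmod (z ord0 i - p ord0 i)).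
  move=> z.
  have ci : {for z, continuous (fun z : 'rV[Cplx R]_d => z ord0 i - p ord0 i)}.
    exact: (cvgB (@coord_continuous _ _ _ ord0 i z) (cvg_cst _)).
  have ci' : {for z, continuous (fun z => cmod (z ord0 i - p ord0 i))}.
    exact: continuous_comp ci (@cmod_continuous _ _).
  exact: (cvgM ci' ci').
rewrite (_ : (fun z => _) =
    (fun z => \sum_i cmod (z ord0 i - p ord0 i) * cmod (z ord0 i - p ord0 i))).
  by apply: continuous_big => // ; exact: add_continuous.
by apply/funext => y; apply: eq_bigr => i _; rewrite expr2.
Qed.

(** If y in Q is close to 2 q, then 2 q - y is close to 0 and lies in Q, and q is
the midpoint of y and 2 q - y. *)
Lemma not_closure_double Q q : open Q -> Q 0 ->
  (forall z (l : Cplx R), Q z -> cmod l <= 1 -> Q (l *: z)) ->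
  convex_set Q -> ~ Q q -> ~ closure Q (2 *: q).
Proof.
move=> oQ Q0 circ cQ nQq clq; apply: nQq.
have /nbhs_rowP[e e0 He] : nbhs (0 : 'rV[Cplx R]_d) Q by exact: open_nbhs_nbhs.
have /clq[y [Qy hy]] :
    nbhs (2 *: q) [set y | forall i, cmod (y ord0 i - (2 *: q) ord0 i) < e].
  by apply/nbhs_rowP; exists e.
have Qd : Q (2 *: q - y).
  by apply: He => i; have := hy i; rewrite !mxE subr0 cmodBC.
have h01 : 0 <= (1 / 2 : R) <= 1 by apply/andP; split; lra.
have := convex_setE cQ Qy Qd h01.
have r2 : rc (1 / 2 : R) * 2 = 1.
  by rewrite -(rc_nat R 2) -rcM -rc1; congr rc; field.
have -> : 1 - rc (1 / 2 : R) = rc (1 / 2).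
  by rewrite -{1}r2; ring.
by rewrite -scalerDr [y + _]addrC subrK scalerA r2 scale1r.
Qed.

(** Points with a coordinate of modulus larger than T are farther from p than the
origin is, so the minimum may be sought in a compact polydisc. *)
Lemma closest_point Q p : Q 0 -> exists2 z, closure Q z &
  forall y, closure Q y -> sqdist z p <= sqdist y p.
Proof.
move=> Q0.
pose T := \sum_i cmod (p ord0 i) + sqdist 0 p + 1.
have s0 : 0 <= sqdist 0 p by apply: sumr_ge0 => i _; rewrite exprn_ge0 // cmod_ge0.
have T0 : 0 <= T by rewrite !addr_ge0 //; apply: sumr_ge0 => i _; rewrite cmod_ge0.
pose D : set 'rV[Cplx R]_d := [set z | forall i, cmod (z ord0 i) <= T].
have cD : compact D.
  exact: (@rV_compact _ d (fun=> [set x : Cplx R | cmod x <= T])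
    (fun=> @compact_closed_disc R T)).
pose A := D `&` closure Q.
have cA : compact A by apply: compact_closedI => //; exact: closed_closure.
have cl0 : closure Q 0 by exact: subset_closure.
have A0 : A 0 by split=> // i; rewrite mxE cmod0.
have cf : {within A, continuous (fun z => sqdist z p)}.
  by apply: continuous_subspaceT; exact: sqdist_continuous.
have [z] := compact_EVT_min (ex_intro _ 0 A0) cA cf.
move=> /set_mem[_ cz] min; exists z => // y cy.
have [Dy|nDy] := pselect (D y); first exact: (min y (mem_set (conj Dy cy))).
apply: le_trans (min 0 (mem_set A0)) _.
have /existsNP[i /negP] := nDy; rewrite -ltNge => Ti.
have pi : cmod (p ord0 i) <= \sum_i cmod (p ord0 i).
  by rewrite (bigD1 i) //= lerDl; apply: sumr_ge0 => j _; rewrite cmod_ge0.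
have ypi : sqdist 0 p + 1 <= cmod (y ord0 i - p ord0 i).
  have := cmodD (y ord0 i - p ord0 i) (p ord0 i); rewrite subrK.
  by move: Ti; rewrite /T; lra.
apply: le_trans (_ : cmod (y ord0 i - p ord0 i) ^+ 2 <= _).
  rewrite expr2; have := ler_pM (addr_ge0 s0 ler01) (addr_ge0 s0 ler01) ypi ypi.
  by apply: le_trans; have := sqr_ge0 (sqdist 0 p); lra.
by rewrite /sqdist (bigD1 i) //= lerDl; apply: sumr_ge0 => j _;
  rewrite exprn_ge0 // cmod_ge0.
Qed.

Lemma Re_sum (I : Type) (s : seq I) (F : I -> Cplx R) :
  complex.Re (\sum_(i <- s) F i) = \sum_(i <- s) complex.Re (F i).
Proof.
elim/big_rec2: _ => // i u v _ <-.
by case: (F i) => a b; case: v.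
Qed.

Lemma convex_closure_segment Q z y (t : R) : convex_set Q -> closure Q z -> Q y ->
  0 <= t <= 1 -> closure Q ((1 - rc t) *: z + rc t *: y).
Proof.
move=> cQ cz Qy t01 B /nbhs_rowP[e e0 He].
have /cz[x [Qx hx]] : nbhs z [set x | forall i, cmod (x ord0 i - z ord0 i) < e].
  by apply/nbhs_rowP; exists e.
exists ((1 - rc t) *: x + rc t *: y); split; first exact: convex_setE.
apply: He => i; apply: le_lt_trans (hx i).
rewrite !mxE [X in cmod X](_ : _ = (1 - rc t) * (x ord0 i - z ord0 i));
  last by ring.
rewrite cmodM ler_piMl ?cmod_ge0 //.
case/andP: t01 => t0 t1.
rewrite (_ : 1 - rc t = rc (1 - t)) ?cmod_rc ?ger0_norm; last 1 first.
- by rewrite /rc rmorphB rmorph1.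
- by lra.
- by rewrite subr_ge0.
Qed.

Lemma sqdist_ge0 x y : 0 <= sqdist x y.
Proof. by apply: sumr_ge0 => i _; rewrite exprn_ge0 // cmod_ge0. Qed.

Lemma sqdist_segment z y p (t : R) :
  sqdist ((1 - rc t) *: z + rc t *: y) p =
  sqdist z p + t * (2 * \sum_i cdot (z ord0 i - p ord0 i) (y ord0 i - z ord0 i)
                    + t * sqdist y z).
Proof.
rewrite /sqdist !mulr_sumr -!big_split /= mulr_sumr -big_split /=.
apply: eq_bigr => i _; rewrite !mxE.
rewrite [X in cmod X](_ : _ =
  (z ord0 i - p ord0 i) + rc t * (y ord0 i - z ord0 i)); last by ring.
rewrite cmod_sqrD cmodM cmod_rc exprMn real_normK ?num_real //.
have -> : cdot (z ord0 i - p ord0 i) (rc t * (y ord0 i - z ord0 i)) =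
    t * cdot (z ord0 i - p ord0 i) (y ord0 i - z ord0 i).
  by case: (z ord0 i - p ord0 i) (y ord0 i - z ord0 i) => [? ?] [? ?];
    rewrite /cdot /=; ring.
by ring.
Qed.

(** First-order necessary condition for a minimum at the left end of a segment. *)
Lemma quadratic_slope_ge0 (D E : R) : 0 <= E ->
  (forall t, 0 < t -> t <= 1 -> 0 <= 2 * D + t * E) -> 0 <= D.
Proof.
move=> E0 var; rewrite leNgt; apply/negP => D0.
pose t := Num.min 1 (- D / (E + 1)).
have t0 : 0 < t by rewrite lt_min ltr01 divr_gt0 ?oppr_gt0 // ltr_wpDl.
have t1 : t <= 1 by rewrite ge_min lexx.
have tE : t * E <= - D.
  apply: le_trans (_ : t * (E + 1) <= _);
    first by rewrite ler_wpM2l ?(ltW t0) // lerDl.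
  by rewrite -ler_pdivlMr ?ltr_wpDl // ge_min lexx orbT.
by have := var t t0 t1; lra.
Qed.

(** Let z be a point of the closure of Q closest to a point p outside this closure.
The real part of the functional represented by z - p is minimal over Q at z, so
it is bounded below on Q; as Q is invariant under rotations, a lower bound of the
real part bounds the modulus. *)
Lemma bounded_functional Q : complete_circular_domain Q -> convex_set Q ->
  Q <> setT ->
  exists v, v != 0 /\ exists B : R, forall z, Q z -> cmod (linval v z) <= B.
Proof.
move=> [oQ _ Q0 circ] cQ QT.
have [q nQq] : exists q, ~ Q q.
  apply: contrapT => /forallNP H; apply: QT; apply/seteqP; split=> // x _.
  exact: contrapT (H x).
pose p : 'rV[Cplx R]_d := 2 *: q.
have ncl : ~ closure Q p by exact: not_closure_double.
have [z cz min] := closest_point p Q0.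
pose w i := z ord0 i - p ord0 i.
(* The conjugate of z - p, because [linval] is bilinear. *)
pose v : 'rV[Cplx R]_d := \row_i Complex (complex.Re (w i)) (- complex.Im (w i)).
have ReL y : complex.Re (linval v y) = \sum_i cdot (w i) (y ord0 i).
  rewrite Re_sum; apply: eq_bigr => i _; rewrite mxE.
  by case: (w i) => a b; case: (y ord0 i) => a' b'; rewrite /cdot /=; ring.
exists v; split.
  apply: contra_not_neq ncl => v0; suff -> : p = z by [].
  apply/rowP => i; apply/eqP; rewrite eq_sym -subr_eq0; apply/eqP.
  have : v ord0 i = 0 by rewrite v0 mxE.
  rewrite mxE /w; case: (z ord0 i - p ord0 i) => a b /= [-> /eqP].
  by rewrite oppr_eq0 => /eqP ->.
pose m := \sum_i cdot (w i) (z ord0 i).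
have half y : Q y -> m <= complex.Re (linval v y).
  move=> Qy; rewrite ReL.
  pose D := \sum_i cdot (w i) (y ord0 i - z ord0 i).
  have -> : \sum_i cdot (w i) (y ord0 i) = D + m.
    by rewrite /D /m -big_split /=; apply: eq_bigr => i _; rewrite -cdotDr subrK.
  rewrite lerDr; apply: (@quadratic_slope_ge0 D (sqdist y z));
    first exact: sqdist_ge0.
  move=> t t0 t1.
  have t01 : 0 <= t <= 1 by rewrite (ltW t0).
  have := min _ (convex_closure_segment cQ cz Qy t01).
  by rewrite sqdist_segment lerDl (pmulr_rge0 _ t0).
exists (- m) => y Qy.
have [u u1 Eu] := polar_form (linval v y).
have cu : cmod u = 1 by apply: rcI; rewrite -cmodE u1.
have u0 : u != 0 by rewrite -cmod_gt0 cu.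
have cu' : cmod (- u^-1) <= 1 by rewrite cmodN cmodV cu invr1.
have := half _ (circ _ _ Qy cu').
have E : - u^-1 * linval v y = - rc (cmod (linval v y)).
  by rewrite {1}Eu mulrA mulNr (mulVf u0) mulN1r.
rewrite linvalZ E => my; rewrite lerNr; exact: my.
Qed.

End BoundedFunctional.

(** * The extremal function *)

Section Sharpness.
Variables (R : realType).

(** Divide a bounded nonzero functional by its supremum S over Q. The supremum is
not attained: Q is open, so it contains (1 + t) z for some t > 0 whenever it
contains z. *)
Lemma norming_functional d (Q : set 'rV[Cplx R]_d) :
  complete_circular_domain Q -> convex_set Q -> Q <> setT ->
  exists v, (forall z, Q z -> cmod (linval v z) < 1) /\
    forall r : R, r < 1 -> exists2 b, Q b & r < cmod (linval v b).
Proof.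
move=> dQ cQ QT; have [v [v0 [B LB]]] := bounded_functional dQ cQ QT.
have [oQ _ Q0 circ] := dQ.
pose A : set R := [set cmod (linval v z) | z in Q].
have hA : has_sup A.
  by split; [exists (cmod (linval v 0)); exists 0|exists B => _ [z Qz <-];
    exact: LB].
pose S := sup A.
have LS z : Q z -> cmod (linval v z) <= S.
  by move=> Qz; apply: sup_upper_bound => //; exists z.
have [i vi] : exists i, v ord0 i != 0.
  apply/existsP; apply: contraNT v0; rewrite negb_exists => /forallP H.
  by apply/eqP/rowP => i; rewrite mxE; apply/eqP; have := H i; rewrite negbK.
have S0 : 0 < S.
  have /nbhs_rowP[e e0 He] : nbhs (0 : 'rV[Cplx R]_d) Q by exact: open_nbhs_nbhs.
  have e20 : 0 < e / 2 by rewrite divr_gt0.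
  have Qd : Q (rc (e / 2) *: delta_mx ord0 i).
    apply: He => j; rewrite !mxE subr0 cmodM cmod_rc gtr0_norm //=.
    apply: le_lt_trans (_ : e / 2 < e); last by lra.
    by case: (j == i); rewrite ?cmod1 ?cmod0 ?mulr1 ?mulr0 // ltW.
  apply: lt_le_trans (LS _ Qd).
  rewrite linvalZ cmodM cmod_rc (gtr0_norm e20) mulr_gt0 // cmod_gt0.
  rewrite /linval (bigD1 i) //= big1 => [|j ji]; last first.
    by rewrite mxE (negPf ji) mulr0.
  by rewrite mxE !eqxx mulr1 addr0.
have lin z : linval ((rc S)^-1 *: v) z = (rc S)^-1 * linval v z.
  by rewrite /linval mulr_sumr; apply: eq_bigr => j _; rewrite mxE mulrA.
have clin z : cmod (linval ((rc S)^-1 *: v) z) = cmod (linval v z) / S.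
  by rewrite lin cmodM cmodV cmod_rc (gtr0_norm S0) mulrC.
exists ((rc S)^-1 *: v); split=> [z Qz|r r1].
  rewrite clin ltr_pdivrMr // mul1r.
  have [e e0 He] := proj1 (nbhs_rowP _ _) (open_nbhs_nbhs (conj oQ Qz)).
  pose T := \sum_j cmod (z ord0 j).
  have T0 : 0 <= T by apply: sumr_ge0 => j _; exact: cmod_ge0.
  pose t := e / (T + 1).
  have t0 : 0 < t by rewrite divr_gt0 // ltr_wpDl.
  have Qt : Q (rc (1 + t) *: z).
    apply: He => j; rewrite mxE.
    rewrite [X in cmod X](_ : _ = rc t * z ord0 j); last by rewrite rcD rc1; ring.
    rewrite cmodM cmod_rc gtr0_norm // /t mulrAC ltr_pdivrMr ?ltr_wpDl //
      ltr_pM2l //.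
    apply: le_lt_trans (_ : T < _); last by rewrite ltrDl.
    by rewrite /T (bigD1 j) //= lerDl; apply: sumr_ge0 => l _; exact: cmod_ge0.
  have := LS _ Qt; rewrite linvalZ cmodM cmod_rc gtr0_norm;
    last by rewrite addr_gt0.
  have := cmod_ge0 (linval v z); rewrite le_eqVlt => /orP[/eqP <- _ //|z0].
  by have := mulr_gt0 t0 z0; rewrite mulrDl mul1r; lra.
have : r * S < S by rewrite gtr_pMl.
move=> /(sup_gt (proj1 hA))[_ [b Qb <-] rb].
by exists b => //; rewrite clin ltr_pdivlMr.
Qed.

Definition linpoly d (v : 'rV[Cplx R]_d) : mpoly d (Cplx R) :=
  \sum_(i < d) v ord0 i *: mpolyX _ (mnm1 i).

(** Taylor coefficients at the origin of the disc automorphism [moebius a]. *)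
Definition moebius_coef (a : R) n : Cplx R :=
  if n is m.+1 then - rc ((1 - a ^+ 2) * a ^+ m) else rc a.

Definition moebius (a : R) (x : Cplx R) : Cplx R := (rc a - x) / (1 - rc a * x).

Lemma linpoly_homogeneous d (v : 'rV[Cplx R]_d) n (c : Cplx R) :
  homogeneous n (c *: linpoly v ^+ n).
Proof.
have hom1 : homogeneous 1 (linpoly v).
  by apply: rpred_sum => i _; apply: dhomogZ; rewrite dhomogX /= mdeg1.
by apply: dhomogZ; have := dhomogMn n hom1; rewrite mul1n.
Qed.

Lemma polyval_linpoly d (v : 'rV[Cplx R]_d) n (c : Cplx R) z :
  polyval (c *: linpoly v ^+ n) z = c * linval v z ^+ n.
Proof.
rewrite /polyval mevalZ rmorphXn /= /linpoly raddf_sum /=.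
by congr (_ * _ ^+ _); apply: eq_bigr => i _; rewrite mevalZ mevalXU.
Qed.

Lemma moebius_partial_sum (a : R) (x : Cplx R) n : 1 - rc a * x != 0 ->
  \sum_(i < n.+1) moebius_coef a i * x ^+ i =
  moebius a x + rc (1 - a ^+ 2) * x * (rc a * x) ^+ n / (1 - rc a * x).
Proof.
move=> ax; rewrite /moebius; elim: n => [|n IH].
  rewrite big_ord_recr big_ord0 /= !expr0 /rc rmorphB rmorph1 rmorphXn /= -/(rc a).
  by field.
rewrite big_ord_recr /= {}IH !exprMn rcM !exprS -rcX /rc rmorphB rmorph1
  rmorphXn /= -/(rc a).
by field.
Qed.

Lemma moebius_denom (a : R) (x : Cplx R) : 0 < a < 1 -> cmod x < 1 ->
  1 - rc a * x != 0.
Proof.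
move=> /andP[a0 a1] x1; rewrite -cmod_gt0.
have := cmodB 1 (rc a * x); have := cmodD (1 - rc a * x) (rc a * x).
rewrite subrK cmod1 cmodM cmod_rc gtr0_norm //.
have : a * cmod x < 1 by apply: mulr_ilt1; rewrite ?cmod_ge0 // ltW.
lra.
Qed.

(** This is the identity
|1 - a x|^2 - |a - x|^2 = (1 - a^2) (1 - |x|^2). *)
Lemma moebius_lt1 (a : R) (x : Cplx R) : 0 < a < 1 -> cmod x < 1 ->
  cmod (moebius a x) < 1.
Proof.
move=> a01 x1; have D := moebius_denom a01 x1; case/andP: a01 => a0 a1.
rewrite /moebius cmodM cmodV ltr_pdivrMr ?cmod_gt0 // mul1r.
rewrite -(@ltr_pXn2r _ 2) ?nnegrE ?cmod_ge0 //.
have x2 : cmod x ^+ 2 < 1 by rewrite expr_lt1 ?cmod_ge0.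
have a2 : a ^+ 2 < 1 by rewrite expr_lt1 ?ltW.
have : 0 < (1 - a ^+ 2) * (1 - cmod x ^+ 2) by rewrite mulr_gt0 // subr_gt0.
rewrite !cmod_sqr.
have -> : cdot (rc a - x) (rc a - x) =
  cdot (1 - rc a * x) (1 - rc a * x) - (1 - a ^+ 2) * (1 - cdot x x).
  by case: x {x1 D x2} => u w; rewrite /cdot /=; ring.
lra.
Qed.

Lemma moebius_series (a : R) (x : Cplx R) : 0 < a < 1 -> cmod x < 1 ->
  series (fun n => moebius_coef a n * x ^+ n) @ \oo --> moebius a x.
Proof.
move=> a01 x1; have D := moebius_denom a01 x1; case/andP: (a01) => a0 a1.
apply/series_cmodP => e e0.
pose q := a * cmod x.
have q0 : 0 <= q by rewrite mulr_ge0 ?cmod_ge0 // ltW.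
have q1 : q < 1 by apply: mulr_ilt1; rewrite ?cmod_ge0 // ltW.
have q01 : 0 <= q < 1 by rewrite q0.
have e20 : 0 < e / 2 by rewrite divr_gt0.
pose K := cmod (rc (1 - a ^+ 2) * x / (1 - rc a * x)).
have [N HN] := geometric_eventually_le K q01 e20.
exists N.+1 => -[//|n] nN; rewrite moebius_partial_sum // addrC addKr.
apply: le_lt_trans (_ : e / 2 < e); last by lra.
apply: le_trans (HN n nN).
rewrite [X in cmod X](_ : _ =
  (rc (1 - a ^+ 2) * x / (1 - rc a * x)) * (rc a * x) ^+ n); last by ring.
by rewrite cmodM cmodX [cmod (rc a * x)]cmodM cmod_rc gtr0_norm.
Qed.

Lemma moebius_differentiable d (v z : 'rV[Cplx R]_d) (a : R) : 0 < a < 1 ->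
  cmod (linval v z) < 1 ->
  differentiable (fun z => moebius a (linval v z)) z.
Proof.
move=> a01 x1.
have dL : differentiable (linval v : 'rV[Cplx R]_d -> Cplx R) z.
  have -> : (linval v : 'rV[Cplx R]_d -> Cplx R) =
      \sum_(i < d) (fun z : 'rV[Cplx R]_d => v ord0 i *: (z ord0 i : Cplx R)).
    by apply/funext => y; rewrite fct_sumE.
  apply: differentiable_sum => i; apply: differentiableZ;
    exact: differentiable_coord.
have dN : differentiable (fun z => rc a - linval v z) z.
  exact: differentiableB (differentiable_cst _ _) dL.
have dD : differentiable (fun z => 1 - rc a * linval v z) z.
  exact: differentiableB (differentiable_cst _ _) (differentiableZ (rc a) dL).
exact: differentiableM dN (differentiableV dD (moebius_denom a01 x1)).
Qed.

End Sharpness.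

(** * Sharpness of the radius *)

Section Extremal.
Variables (R : realType).

Lemma finite_series_cvg (a : nat -> Cplx R) l N :
  (forall n, (N <= n)%N -> \sum_(i < n) a i = l) -> series a @ \oo --> l.
Proof.
move=> H; apply/series_cmodP => e e0; exists N => n /H ->.
by rewrite subrr cmod0.
Qed.

(** Around h0 the power series is the binomial expansion of (h0 + (h - h0))^k. *)
Lemma schwarz_class_power k : schwarz_class k (fun h : Cplx R => h ^+ k).
Proof.
have der j : derive1n j (fun h : Cplx R => h ^+ k) 0 = (j`!)%:R * (j == k)%:R.
  apply: (derive1n_coef (c := fun n => (n == k)%:R) j ltr01) => h _.
  apply: (finite_series_cvg (N := k.+1)) => n kn.
  rewrite (bigD1 (Ordinal kn)) //= eqxx mul1r big1 ?addr0 // => i.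
  by rewrite -val_eqE /= => /negPf ->; rewrite mul0r.
split.
- split=> [h0 _|h h1]; last first.
    by rewrite cmodX exprn_ile1 ?cmod_ge0 // ltW.
  exists 1, (fun n => h0 ^+ (k - n) *+ 'C(k, n)); split; first exact: ltr01.
  move=> h _; apply: (finite_series_cvg (N := k.+1)) => n kn.
  rewrite -{2}[h](subrK h0) [_ - _ + _]addrC exprDn.
  rewrite (big_ord_widen n (fun i =>
    (h0 ^+ (k - i) * (h - h0) ^+ i) *+ 'C(k, i)) kn).
  rewrite [RHS]big_mkcond /=; apply: eq_bigr => i _.
  case: ifPn => [_|]; first by rewrite mulrnAl.
  by rewrite -leqNgt => ki; rewrite bin_small // mulr0n mul0r.
- by move=> j jk; rewrite der ltn_eqF // mulr0.
- rewrite der eqxx mulr1; apply/eqP.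
  by rewrite pnatr_eq0 -lt0n fact_gt0.
Qed.

(** The sum of the |c_n| x^n for [moebius a] is a + (1 - a^2) x / (1 - a x), and it
exceeds 1 exactly when (1 + 2 a) x > 1. For x > 1/3 this holds for a close to 1. *)
Lemma extremal_parameter (x : R) : 1 / 3 < x -> x < 1 ->
  exists2 a, 0 < a < 1 & 1 < (1 + 2 * a) * x.
Proof.
move=> x3 x1; have x0 : 0 < x by lra.
have ix : 1 < x^-1 < 3.
  apply/andP; split; first by rewrite invf_gt1.
  by rewrite -[ltRHS]invrK ltf_pV2 ?posrE; lra.
(* The midpoint of 1 and of the solution a of (1 + 2 a) x = 1. *)
exists ((1 + (x^-1 - 1) / 2) / 2); first by apply/andP; split; lra.
rewrite -ltr_pdivrMr // mul1r; lra.
Qed.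

Lemma moebius_bohr_sum_gt1 (a x : R) : 0 < a < 1 -> 0 < x < 1 ->
  1 < (1 + 2 * a) * x ->
  exists n, 1 < \sum_(0 <= i < n) cmod (moebius_coef a i) * x ^+ i.
Proof.
move=> /andP[a0 a1] /andP[x0 x1] ax.
have q01 : 0 <= a * x < 1.
  by apply/andP; split; [rewrite mulr_ge0 // ltW|apply: mulr_ilt1; rewrite // ltW].
have D : 0 < 1 - a * x by case/andP: q01; lra.
have a2 : 0 < 1 - a ^+ 2 by rewrite subr_gt0 expr_lt1 ?ltW.
pose V := a + (1 - a ^+ 2) * x / (1 - a * x).
have V1 : 1 < V.
  rewrite /V -ltrBlDl ltr_pdivlMr //.
  have -> : (1 - a ^+ 2) * x = (1 - a) * ((1 + a) * x) by ring.
  by rewrite ltr_pM2l ?subr_gt0 //; lra.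
have e0 : 0 < (V - 1) / 2 by lra.
have [N HN] := geometric_eventually_le ((1 - a ^+ 2) * x / (1 - a * x)) q01 e0.
exists N.+1.
have -> : \sum_(0 <= i < N.+1) cmod (moebius_coef a i) * x ^+ i =
    V - (1 - a ^+ 2) * x / (1 - a * x) * (a * x) ^+ N.
  elim: N {HN} => [|n IH].
    rewrite big_nat1 /= cmod_rc gtr0_norm // !expr0 /V; ring.
  rewrite big_nat_recr //= {}IH cmodN cmod_rc ger0_norm; last first.
    by rewrite mulr_ge0 ?exprn_ge0 ?ltW.
  rewrite !exprMn !exprS; field.
  by rewrite gt_eqF.
by have := HN N (leqnn N); lra.
Qed.

(** Take f = [moebius a] composed with a norming functional, and w(h) = h^k. At a
real point h = eta with 3^(-1/k) < eta < R', the number eta^k exceeds 1/3, and it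
still does after multiplication by the value of the functional at a suitable b,
which is as close to 1 as desired. *)
Lemma bohr_radius_sharp (d k : nat) (Q : set 'rV[Cplx R]_d) (R' : R) :
  (0 < k)%N -> complete_circular_domain Q -> convex_set Q -> Q <> setT ->
  1 / 3 `^ (k%:R^-1) < R' -> R' <= 1 ->
  exists (f : 'rV[Cplx R]_d -> Cplx R) (P : nat -> mpoly d (Cplx R))
         (w : Cplx R -> Cplx R),
    [/\ bohr_admissible Q f P, schwarz_class k w & ~ bohr_inequality_in Q P w R'].
Proof.
move=> k0 dQ cQ QT HR R1.
have [v [v1 vsup]] := norming_functional dQ cQ QT.
have [_ _ Q0 circ] := dQ.
pose H : R := 1 / 3 `^ (k%:R^-1).
have H0 : 0 < H by rewrite divr_gt0 // powR_gt0.
have Hk : H ^+ k = 1 / 3 by exact: radius_powk.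
pose eta := (H + R') / 2.
have Heta : H < eta by rewrite /eta; rewrite -/H in HR; lra.
have etaR : eta < R' by rewrite /eta; rewrite -/H in HR; lra.
have eta0 : 0 < eta := lt_trans H0 Heta.
have etak : 1 / 3 < eta ^+ k.
  by rewrite -Hk ltr_pXn2r // nnegrE ltW.
have etak1 : eta ^+ k <= 1 by rewrite exprn_ile1 // ltW //; exact: lt_le_trans R1.
have etak0 : 0 < eta ^+ k by rewrite exprn_gt0.
have [|b Qb vb] := vsup (1 / 3 / eta ^+ k);
  first by rewrite (ltr_pdivrMr _ _ etak0) [ltRHS]mul1r.
pose x := eta ^+ k * cmod (linval v b).
have x3 : 1 / 3 < x by rewrite /x [ltRHS]mulrC -(ltr_pdivrMr _ _ etak0).
have x0 : 0 < x by apply: lt_trans x3; rewrite divr_gt0.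
have x1 : x < 1.
  by apply: le_lt_trans (v1 _ Qb); rewrite /x ler_piMl // cmod_ge0.
have [a a01 ax] := extremal_parameter x3 x1.
exists (fun z => moebius a (linval v z)).
exists (fun n => moebius_coef a n *: linpoly v ^+ n), (fun h => h ^+ k).
split; last 2 first.
- exact: schwarz_class_power.
- have x01 : 0 < x < 1 by rewrite x0.
  have [n gt1] := moebius_bohr_sum_gt1 a01 x01 ax.
  move=> /(_ b (rc eta)) ineq.
  have bD t : unit_disc t -> Q (t *: b) by move=> t1; apply: circ => //; exact: ltW.
  have ceta : cmod (rc eta) = eta by rewrite cmod_rc gtr0_norm.
  have eta1 : unit_disc (rc eta) by rewrite /unit_disc /= ceta; lra.
  have := ineq bD eta1; rewrite ceta => /(_ etaR).
  apply/negP; rewrite -ltNge.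
  apply: lt_le_trans (nneseries_lim_ge n _); last by move=> i _ _;
    rewrite lee_fin cmod_ge0.
  rewrite sumEFin lte_fin; apply: lt_le_trans gt1 _; apply: ler_sum => i _.
  rewrite polyval_linpoly cmodM cmodX linvalZ cmodM cmodX ceta.
  exact: lexx.
split.
- by move=> z Qz; apply: moebius_differentiable => //; exact: v1.
- split=> [n|z Qz]; first exact: linpoly_homogeneous.
  rewrite (_ : (fun n => _) = (fun n => moebius_coef a n * linval v z ^+ n)).
    by apply: moebius_series => //; exact: v1.
  by apply/funext => n; exact: polyval_linpoly.
- by apply: moebius_lt1 => //; exact: v1.
- by move=> z Qz; apply: moebius_lt1 => //; exact: v1.
Qed.

End Extremal.

Theorem theorem2p1 (R : realType) (d k : nat) (hd : (0 < d)%N) (hk : (0 < k)%N)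
    (Q : set 'rV[Cplx R]_d) (hQ : complete_circular_domain Q) :
  (forall (f : 'rV[Cplx R]_d -> Cplx R) (P : nat -> mpoly d (Cplx R))
          (w : Cplx R -> Cplx R),
      bohr_admissible Q f P -> schwarz_class k w ->
      bohr_inequality_in Q P w (1 / 3 `^ (k%:R^-1)))
  /\
  (convex_set Q -> Q <> setT ->
   forall R' : R, 1 / 3 `^ (k%:R^-1) < R' -> R' <= 1 ->
   exists (f : 'rV[Cplx R]_d -> Cplx R) (P : nat -> mpoly d (Cplx R))
          (w : Cplx R -> Cplx R),
     [/\ bohr_admissible Q f P, schwarz_class k w
       & ~ bohr_inequality_in Q P w R']).
Proof.
split=> [f P w|cQ QT R']; first exact: bohr_inequality.
exact: bohr_radius_sharp.
Qed.
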